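(* If both the function $F_{ij}(s-u^i,s'-u^j)$ and the function $$\widetilde F_{ij}(s-u^i,s'-u^j)=\frac{\sqrt{f^j(u^j-s')}}{\sqrt{f^i(u^i-s)}}\,F_{ij}(s-u^i,s'-u^j)$$ satisfy the Zakharov differential relation, then the corresponding rotation coefficients $\beta_{ij}(u)$, given by $\beta_{ij}(s,u)=K_{ji}(s,s,u)$, satisfy both the equations $$\frac{\partial\beta_{ij}}{\partial u^i}+\frac{\partial\beta_{ji}}{\partial u^j}+\sum_{p\neq i,\ p\neq j}\beta_{pi}\beta_{pj}=0,\qquad i\neq j,$$ and the equations $$\sqrt{f^i(u^i)}\,\frac{\partial\left(\sqrt{f^i(u^i)}\,\beta_{ij}\right)}{\partial u^i}+\sqrt{f^j(u^j)}\,\frac{\partial\left(\sqrt{f^j(u^j)}\,\beta_{ji}\right)}{\partial u^j}+\sum_{p\neq i,\ p\neq j}f^p(u^p)\,\beta_{pi}\beta_{pj}=0,\qquad i\neq j.$$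
   Context: Here $u=(u^1,\dots,u^N)$, the indices run from $1$ to $N$, $f^1,\dots,f^N$ are given functions of a single variable (not identically zero), and $F_{ij}(x,y)$ is a matrix function of two variables, used in Zakharov's dressing method as the ''dressing matrix function'' $F_{ij}(s,s',u)=F_{ij}(s-u^i,s'-u^j)$. The Zakharov differential relation for a dressing function $F_{ij}(s,s',u)$ is $$\frac{\partial F_{ij}(s,s',u)}{\partial s'}+\frac{\partial F_{ji}(s',s,u)}{\partial s}=0,$$ where, in the present case, $F_{ji}(s',s,u)=F_{ji}(s'-u^j,s-u^i)$. $K_{ij}(s,s',u)$ is the solution of the integral equation $$K_{ij}(s,s',u)=F_{ij}(s-u^i,s'-u^j)+\int_s^{\infty}\sum_l K_{il}(s,q,u)\,F_{lj}(q-u^l,s'-u^j)\,dq.$$ The formula $\beta_{ij}(s,u)=K_{ji}(s,s,u)$ gives a family of functions of $u$ depending on the parameter $s$; in the notation $\beta_{ij}(u)$, and in the conclusion, this parameter is suppressed. With $s$ kept explicit, the coefficients $\widetilde\beta_{ij}(s,u)$ obtained in the same way from $\widetilde F_{ij}$ are $\widetilde\beta_{ij}(s,u)=\frac{\sqrt{f^i(u^i-s)}}{\sqrt{f^j(u^j-s)}}\,\beta_{ij}(s,u)$.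
   Formalization: Added: f, F, K are C¹; F and its first derivatives bounded on quadrants; K integrable, K and derivatives dominated by integrable functions; f^j K_ij and (f^j)'K_ij integrable at infinity; no f^i vanishes on an interval. Without decay the claim fails (constant F with F²=0). *)

(* Defs.v *)
From HB Require Import structures.
From mathcomp Require Import all_boot all_order all_algebra complex.
From mathcomp Require Import all_classical all_reals all_analysis.
Import Order.TTheory GRing.Theory Num.Theory.
Import numFieldNormedType.Exports.

Set Implicit Arguments.
Unset Strict Implicit.
Unset Printing Implicit Defensive.

Local Open Scope classical_set_scope.
Local Open Scope ring_scope.
Local Open Scope complex_scope.

(** Calculus for functions with values in R[i].  The variables (s, s', q, u)
    are real; the values are complex because the square roots of the [f i]
    need not be real.  Everything is read off the real and imaginary parts. *)

Section ComplexValued.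
Context {R : realType}.

Definition cderivable (V : normedModType R) (g : V -> R[i]) (x v : V) : Prop :=
  derivable (fun y => complex.Re (g y)) x v /\
  derivable (fun y => complex.Im (g y)) x v.

Definition cderive (V : normedModType R) (g : V -> R[i]) (x v : V) : R[i] :=
  'D_v (fun y => complex.Re (g y)) x +i* 'D_v (fun y => complex.Im (g y)) x.

Definition ccontinuous (V : normedModType R) (g : V -> R[i]) : Prop :=
  continuous (fun y => complex.Re (g y)) /\
  continuous (fun y => complex.Im (g y)).

(* Only used on finite-dimensional V. *)
Definition C1 (V : normedModType R) (g : V -> R[i]) : Prop :=
  (forall x, differentiable (fun y => complex.Re (g y)) x /\
             differentiable (fun y => complex.Im (g y)) x) /\
  (forall v, ccontinuous (fun x => cderive g x v)).

Definition cintegrable (D : set R) (g : R -> R[i]) : Prop :=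
  lebesgue_measure.-integrable D (fun q => (complex.Re (g q))%:E) /\
  lebesgue_measure.-integrable D (fun q => (complex.Im (g q))%:E).

Definition cintegral (D : set R) (g : R -> R[i]) : R[i] :=
  (\int[lebesgue_measure]_(q in D) complex.Re (g q)) +i*
  (\int[lebesgue_measure]_(q in D) complex.Im (g q)).

End ComplexValued.

Section Dressing.
Context {R : realType} {N : nat}.

Definition dressing (F : 'I_N -> 'I_N -> R -> R -> R[i])
    (i j : 'I_N) (s s' : R) (u : 'rV[R]_N) : R[i] :=
  F i j (s - u 0 i) (s' - u 0 j).

(* [r i] stands for a branch of the square root of [f i]; meaningful only
   where [r i (u 0 i - s)] is nonzero. *)
Definition dressing_tilde (r : 'I_N -> R -> R[i])
    (F : 'I_N -> 'I_N -> R -> R -> R[i])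
    (i j : 'I_N) (s s' : R) (u : 'rV[R]_N) : R[i] :=
  r j (u 0 j - s') / r i (u 0 i - s) * dressing F i j s s' u.

Definition zakharov_at (G : 'I_N -> 'I_N -> R -> R -> 'rV[R]_N -> R[i])
    (i j : 'I_N) (s s' : R) (u : 'rV[R]_N) : Prop :=
  cderive (fun t : R => G i j s t u) s' 1 +
  cderive (fun t : R => G j i s' t u) s 1 = 0.

(* For fixed i, s and u the integral equation only involves the i-th row
   [k j s' = K i j s s' u] of K. *)
Definition row_solution (F : 'I_N -> 'I_N -> R -> R -> R[i])
    (i : 'I_N) (s : R) (u : 'rV[R]_N) (k : 'I_N -> R -> R[i]) : Prop :=
  (forall j, cintegrable `[s, +oo[ (k j)) /\
  (forall j s', k j s' = dressing F i j s s' u +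
     cintegral `[s, +oo[ (fun q => \sum_l k l q * dressing F l j q s' u)).

Definition is_the_solution (F : 'I_N -> 'I_N -> R -> R -> R[i])
    (K : 'I_N -> 'I_N -> R -> R -> 'rV[R]_N -> R[i]) : Prop :=
  forall i s u,
    row_solution F i s u (fun j s' => K i j s s' u) /\
    (forall k, row_solution F i s u k -> forall j s', k j s' = K i j s s' u).

Definition rotation (K : 'I_N -> 'I_N -> R -> R -> 'rV[R]_N -> R[i])
    (i j : 'I_N) (s : R) (u : 'rV[R]_N) : R[i] :=
  K j i s s u.

Definition bounded_on_quadrants (g : R * R -> R[i]) : Prop :=
  forall a : R, exists M : R,
    forall x y, a <= x -> a <= y -> Normc.normc (g (x, y)) <= M.

(* Dressing functions: C1, and bounded with their first derivatives where both
   arguments are bounded below. *)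
Definition regular_dressing (F : 'I_N -> 'I_N -> R -> R -> R[i]) : Prop :=
  forall i j, let g := fun p : R * R => F i j p.1 p.2 in
    [/\ C1 g, bounded_on_quadrants g &
        forall v, bounded_on_quadrants (fun p => cderive g p v)].

Definition locally_dominated (g : R * R * 'rV[R]_N -> R[i]) : Prop :=
  forall (s0 : R) (u0 : 'rV[R]_N), exists (a : R) (w : R -> R),
    [/\ a < s0,
        lebesgue_measure.-integrable `[a, +oo[ (fun q => (w q)%:E) &
        \forall p \near (s0, u0), forall q, a <= q ->
          Normc.normc (g (p.1, q, p.2)) <= w q].

(* Domination, locally uniform in (s, u), by an integrable function of the
   integration variable: what differentiation under the integral sign needs. *)
Definition regular_kernel (K : 'I_N -> 'I_N -> R -> R -> 'rV[R]_N -> R[i]) :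
    Prop :=
  forall i j,
    let g := fun p : R * R * 'rV[R]_N => K i j p.1.1 p.1.2 p.2 in
    [/\ C1 g, locally_dominated g &
        forall v, locally_dominated (fun p => cderive g p v)].

(* Together with the boundedness of F, this makes the integrals obtained when
   f j and its derivative are inserted as weights converge absolutely; only
   the behaviour of f j at -oo matters. *)
Definition weight_compatible (f : 'I_N -> R -> R[i])
    (K : 'I_N -> 'I_N -> R -> R -> 'rV[R]_N -> R[i]) : Prop :=
  forall i j s (u : 'rV[R]_N),
    cintegrable `[s, +oo[ (fun q => f j (u 0 j - q) * K i j s q u) /\
    cintegrable `[s, +oo[
      (fun q => cderive (f j) (u 0 j - q) 1 * K i j s q u).

Definition sqrt_branch (f r : 'I_N -> R -> R[i]) : Prop :=
  forall i x, r i x ^+ 2 = f i x /\ (f i x != 0 -> cderivable (r i) x 1).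

Definition pderive (k : 'I_N) (g : 'rV[R]_N -> R[i]) (u : 'rV[R]_N) : R[i] :=
  cderive g u (delta_mx 0 k).

End Dressing.

(* Main.v *)
(** Writing the integral equation as [K (1 - F) = F], one has
    [1 + K = (1 - F)^-1].  The Zakharov relation says that the kernel
    [A = dF/ds'] is antisymmetric, and [B := dK/ds' = (1 + K) A], so
    [B (1 + K)^T = (1 + K) A (1 + K)^T] is antisymmetric too.  On the diagonal
    [s = s'] the integrals of [B K^T] and of its transpose add up to that of a
    total derivative, which leaves
      [B_ij + B_ji = sum_m K_im K_jm].
    Differentiating the integral equation in [u^j] and invoking uniqueness
    gives [dK_ij/du^j = K_ij K_jj - B_ij] for [i != j], which turns this into
    the first equation.  The relation for the second dressing function says
    that [f_j A_ij - f_j' F_ij / 2] is antisymmetric where the [f_i] do not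
    vanish, hence everywhere by density, and the same computation with the
    weight [f_m (u^m - s')] yields the second equation; the first one is the
    case [f = 1]. *)

Require Import Defs.
From HB Require Import structures.
From mathcomp Require Import all_boot all_order all_algebra complex.
From mathcomp Require Import all_classical all_reals all_analysis.
From mathcomp Require Import measurable_realfun ring lra.
Import Order.TTheory GRing.Theory Num.Theory.
Import numFieldNormedType.Exports.
Set Implicit Arguments.
Unset Strict Implicit.
Unset Printing Implicit Defensive.
Local Open Scope classical_set_scope.
Local Open Scope ring_scope.

(** * Real integrals on half-lines and products *)

(** The factor [1/2] has a double role. Clearing the denominators of the [s']-derivative of the
    second dressing function by [r_i r_j], a factor symmetric under exchanging [(i, s)] with
    [(j, s')], leaves [f_j A_ij - r_j r_j' F_ij], and [r_j r_j' = f_j' / 2]: no square root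
    survives, so the kernel is continuous everywhere and a density argument can cross the zeros of
    [f]. The same half makes the weighted row sum plus its transpose an exact derivative. The weight
    acts on the column variable alone, hence commutes with left multiplication by [1 + K]. The
    analytic obstacle is that dressing functions are merely bounded on quadrants, with no decay; all
    decay comes from [K]. Integrals are therefore exchanged under a product bound
    [|K_il(x)| W_m(y) |K_jm(y)|], and boundary terms at infinity vanish because an integrable
    function with a limit has limit [0]. Differentiating in [u^k] also moves the first argument of
    [F_kj] under the integral; integration by parts removes this derivative and forces the
    combination of the [u^k]-derivative with the [s']-derivative in column [k]. *)

Section HalfLine.
Context {R : realType}.
Notation mu := (@lebesgue_measure R).
Implicit Types (G g w : R -> R) (s t : R).

Lemma Rintegral_derive_itvcc G g s t : s <= t ->
  (forall x, is_derive x (1 : R) G (g x)) -> continuous g ->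
  \int[mu]_(x in `[s, t]) g x = G t - G s.
Proof.
move=> st dG cg; move: st; rewrite le_eqVlt => /predU1P[->|st].
  by rewrite set_itv1 Rintegral_set1 subrr.
have cG : continuous G.
  by move=> x; apply/differentiable_continuous/derivable1_diffP/(@ex_derive _ _ _ _ _
    _ _ (dG x)).
rewrite /Rintegral (@continuous_FTC2 _ _ G)//.
- exact: continuous_subspaceT.
- split.
  + by move=> x _; exact: (@ex_derive _ _ _ _ _ _ _ (dG x)).
  + exact/cvg_at_right_filter/cG.
  + exact/cvg_at_left_filter/cG.
- by move=> x _; rewrite derive1E (@derive_val _ _ _ _ _ _ _ (dG x)).
Qed.

(** If [l] were nonzero, [|G|] would exceed [|l| / 2] on some half-line, and a nonzero constant is
    not integrable on a set of infinite measure. *)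
Lemma integrable_cvg_eq0 G s (l : R) :
  mu.-integrable `[s, +oo[ (EFin \o G) -> G x @[x --> +oo] --> l -> l = 0.
Proof.
move=> iG Gl; apply/eqP/negP => /negP l0.
have [/= M] : exists M : R, forall x, M < x -> `|l| / 2 <= `|G x|.
  have l2 : 0 < `|l| / 2 by rewrite divr_gt0// normr_gt0.
  move/cvgrPdist_lt: (Gl) => /(_ _ l2)[/= M [_ HM]].
  exists M => x /HM /= lG; have := ler_normD (l - G x) (G x).
  by rewrite subrK; lra.
move=> HM; pose D := `[Num.max s (M + 1), +oo[%classic : set R.
have DS : D `<=` `[s, +oo[.
  by apply: subset_itvr; rewrite bnd_simp le_max lexx.
have mD : measurable (D : set (measurableTypeR R)) by exact: measurable_itv.
have : mu.-integrable D (cst (`|l| / 2)%:E).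
  apply: (@le_integrable _ _ _ mu D _ _ (EFin \o G)) => //; last first.
    by apply: (@integrableS _ _ R mu _ _ _ _ mD DS iG).
  move=> x; rewrite /D /= in_itv/= andbT ge_max => /andP[_ Mx].
  rewrite lee_fin ger0_norm ?divr_ge0// HM//.
  by apply: lt_le_trans Mx; rewrite ltrDl.
move=> /integrableP[_].
under eq_integral do rewrite gee0_abs ?lee_fin ?divr_ge0//.
rewrite integral_cst// [X in (_ * X)%E](_ : _ = +oo%E); last first.
  by rewrite [LHS](lebesgue_measure_itv `[Num.max s (M + 1), +oo[)/= ltry.
rewrite mulry.
by rewrite gtr0_sg ?divr_gt0 ?normr_gt0// mul1e.
Qed.

(** No decay of [G] is assumed: dominated convergence along [v n] gives [G] the limit [G s] plus the
    integral of [g], and integrability of [G] forces this limit to be [0]. *)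
Lemma Rintegral_derive_itvcy G g s :
  (forall x, is_derive x (1 : R) G (g x)) -> continuous g ->
  mu.-integrable `[s, +oo[ (EFin \o G) ->
  mu.-integrable `[s, +oo[ (EFin \o g) ->
  \int[mu]_(x in `[s, +oo[) g x = - G s.
Proof.
move=> dG cg iG ig; pose D := `[s, +oo[%classic : set R.
have mD : measurable (D : set (measurableTypeR R)) by exact: measurable_itv.
suff Gl : G x @[x --> +oo] --> G s + \int[mu]_(x in D) g x.
  by apply/eqP; rewrite -addr_eq0 addrC; apply/eqP; exact: (integrable_cvg_eq0 iG Gl).
apply/cvg_pinftyP => v voo.
have -> : (fun n => G (v n)) = (fun n => G s + (G (v n) - G s)).
  by apply/funext => n; rewrite addrC subrK.
apply: cvgD; first exact: cvg_cst.
have : (\int[mu]_(x in D) ((g \_ `[s, v n]) x)%:E)%E @[n --> \oo] -->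
  (\int[mu]_(x in D) (g x)%:E)%E.
  apply: (@dominated_cvg _ _ _ mu D mD _ _ (fun x => `|g x|%:E)) => //.
  - move=> n; apply/measurable_EFinP; apply/measurable_restrict => //.
    exact: measurable_funS (continuous_measurable_fun cg).
  - move=> x; rewrite /D /= in_itv/= andbT => sx.
    apply: cvg_EFin; first exact: nearW.
    apply: cvg_near_cst.
    have /cvgryPge/(_ x) := voo; apply: filterS => n xv /=.
    by rewrite patchE mem_set// /= in_itv/= sx.
  - by apply: (@integrable_norm _ _ _ mu D _ ig).
  - move=> n x _ /=; rewrite lee_fin patchE; case: ifPn => //.
    by rewrite normr0.
have := @integrable_fin_num _ _ _ mu D mD _ ig => /fineK <- /fine_cvg.
apply: cvg_trans; apply: near_eq_cvg.
have /cvgryPge/(_ s) := voo; apply: filterS => n sv /=.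
rewrite -(Rintegral_derive_itvcc sv dG cg) -/(Rintegral mu D (g \_ `[s, v n])).
rewrite -Rintegral_mkcondr; congr Rintegral.
by rewrite setIidr//; apply: subset_itvl.
Qed.

End HalfLine.

(** * Exchange of integrals for continuous functions on the plane *)

Section ProductMeasurability.
Context {R : realType}.
Notation mu := (@lebesgue_measure R).

(** The product sigma-algebra is generated by rectangles, and an open set of the plane is a
    countable union of boxes with rational endpoints. *)
Lemma open_measurable_prod (U : set (R * R)) : open U ->
  measurable (U : set (measurableTypeR R * measurableTypeR R)%type).
Proof.
move=> oU; pose box (c : (rat * rat) * (rat * rat)) : set (measurableTypeR R *
  measurableTypeR R)%type :=
  `]ratr c.1.1, ratr c.1.2[%classic `*` `]ratr c.2.1, ratr c.2.2[%classic.
have -> : U = \bigcup_(c in [set c | box c `<=` U]) box c.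
  apply/seteqP; split => [[x y] Uxy|p [c]]; last by apply.
  have /nbhs_ballP[/= e e0 xyU] : nbhs (x, y) U by exact: open_nbhs_nbhs.
  have [/rat_in_itvoo[a +] /rat_in_itvoo[b +]] : x - e < x /\ x < x + e by lra.
  have [/rat_in_itvoo[c +] /rat_in_itvoo[d +]] : y - e < y /\ y < y + e by lra.
  rewrite !in_itv/= => /andP[cy1 cy2] /andP[dy1 dy2] /andP[ax1 ax2] /andP[bx1 bx2].
  exists ((a, b), (c, d)); last by split; rewrite /= in_itv/=; apply/andP.
  move=> [x' y'] /= [] /=; rewrite !in_itv/= => /andP[h1 h2] /andP[h3 h4].
  apply: xyU; split; rewrite /ball/= ltr_norml; lra.
rewrite bigcup_mkcond; apply: countable_bigcupT_measurable => //.
move=> c; case: ifPn => // _.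
by apply: measurableX; exact: measurable_itv.
Qed.

Lemma continuous_measurable_fun_prod (f : R * R -> R) :
  continuous f -> measurable_fun [set: measurableTypeR R * measurableTypeR R] f.
Proof.
move=> /continuousP cf; apply: (measurability _ (RGenOpens.measurableE R)).
move=> _ [_ [a [b ->] <-]]; rewrite setTI.
by apply: open_measurable_prod; apply: cf; exact: interval_open.
Qed.

Lemma Rintegral_exchange (f : R * R -> R) (w1 w2 : R -> R) (D : set R) :
  measurable (D : set (measurableTypeR R)) ->
  continuous f ->
  mu.-integrable D (EFin \o w1) -> mu.-integrable D (EFin \o w2) ->
  (forall x y, D x -> D y -> `|f (x, y)| <= w1 x * w2 y) ->
  \int[mu]_(x in D) \int[mu]_(y in D) f (x, y) =
  \int[mu]_(y in D) \int[mu]_(x in D) f (x, y).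
Proof.
move=> mD cf i1 i2 fw.
(* Extension by zero to the whole plane, where Fubini applies; [e1] and [e2] identify the iterated
   integrals over [D] with those of [e]. *)
pose e (p : measurableTypeR R * measurableTypeR R) := (f p * \1_D p.1 * \1_D p.2)%:E.
have mf := continuous_measurable_fun_prod cf.
have m1D : measurable_fun setT (\1_D : measurableTypeR R ->
  R) by exact: measurable_indic.
have me : measurable_fun [set: measurableTypeR R * measurableTypeR R] e.
  apply/measurable_EFinP; apply: measurable_funM; first apply: measurable_funM => //.
  - exact: (measurableT_comp m1D).
  - exact: (measurableT_comp m1D).
have mf1 x : measurable_fun D (fun y => f (x, y)).
  apply: measurable_funTS; apply: (measurableT_comp mf).
  exact: pair1_measurable.
have mf2 y : measurable_fun D (fun x => f (x, y)).
  apply: measurable_funTS; apply: (measurableT_comp mf).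
  exact: pair2_measurable.
have if1 x : D x -> mu.-integrable D (fun y => (f (x, y))%:E).
  move=> Dx; apply: (@le_integrable _ _ _ mu D mD _ (fun y => (w1 x)%:E * (w2 y)%:E)%E).
  - by apply/measurable_EFinP; exact: mf1.
  - by move=> y Dy; rewrite lee_fin (le_trans (fw _ _ Dx Dy))// ler_norm.
  - exact: (@integrableZl _ _ _ mu D mD _ _ i2).
have if2 y : D y -> mu.-integrable D (fun x => (f (x, y))%:E).
  move=> Dy; apply: (@le_integrable _ _ _ mu D mD _ (fun x => (w2 y)%:E * (w1 x)%:E)%E).
  - by apply/measurable_EFinP; exact: mf2.
  - by move=> x Dx; rewrite lee_fin (le_trans (fw _ _ Dx Dy))// mulrC ler_norm.
  - exact: (@integrableZl _ _ _ mu D mD _ _ i1).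
have e1 : (\int[mu]_(x in D) (\int[mu]_(y in D) f (x, y))%:E =
    \int[mu]_x \int[mu]_y e (x, y))%E.
  rewrite integral_mkcond; apply: eq_integral => x _; rewrite patchE.
  case: ifPn => [|xD].
    rewrite inE => Dx; rewrite fineK; last exact: (@integrable_fin_num _ _ _ mu D mD
      _ (if1 x Dx)).
    rewrite integral_mkcond; apply: eq_integral => y _;
      rewrite patchE /e/= (_ : \1_D x = 1) ?mulr1; last by rewrite indicE mem_set.
    by rewrite indicE; case: ifPn => _; rewrite ?mulr1 ?mulr0.
  by rewrite integral0_eq// => y _; rewrite /e/= indicE (negbTE xD) mulr0 mul0r.
have e2 : (\int[mu]_(y in D) (\int[mu]_(x in D) f (x, y))%:E =
    \int[mu]_y \int[mu]_x e (x, y))%E.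
  rewrite integral_mkcond; apply: eq_integral => y _; rewrite patchE.
  case: ifPn => [|yD].
    rewrite inE => Dy; rewrite fineK; last exact: (@integrable_fin_num _ _ _ mu D mD
      _ (if2 y Dy)).
    rewrite integral_mkcond; apply: eq_integral => x _;
      rewrite patchE /e/= (_ : \1_D y = 1) ?mulr1; last by rewrite indicE mem_set.
    by rewrite indicE; case: ifPn => _; rewrite ?mulr1 ?mulr0.
  by rewrite integral0_eq// => x _; rewrite /e/= !indicE (negbTE yD) mulr0.
rewrite {1 3}/Rintegral e1 e2; congr fine; apply: Fubini.
apply/integrable12ltyP => //.
have /integrableP[_ j1] := i1; have /integrableP[_ j2] := i2.
(* The bounds [w1] and [w2] carry no sign condition, so Tonelli is run with their absolute values;
   the double integral of [|e|] is at most [c] times the integral of [|w1|]. *)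
pose c := (\int[mu]_(y in D) `|(w2 y)%:E|)%E.
have mw1 : measurable_fun D (fun x => c * `|(w1 x)%:E|)%E.
  by apply: measurable_funeM; apply: measurableT_comp => //;
    exact: (measurable_int _ i1).
have mw2 x : measurable_fun D (fun y => `|(w1 x)%:E| * `|(w2 y)%:E|)%E.
  by apply: measurable_funeM; apply: measurableT_comp => //;
    exact: (measurable_int _ i2).
apply: (@le_lt_trans _ _ (\int[mu]_(x in D) (c * `|(w1 x)%:E|))%E).
  rewrite [leRHS]integral_mkcond.
  apply: ge0_le_integral => //.
  - by move=> x _; exact: integral_ge0.
  - apply: (measurable_fun_fubini_tonelli_F (fun p => `|e p|%E)) => //.
    exact: measurableT_comp.
  - exact: (measurable_restrictT _ mD).1 mw1.
  - move=> x _; rewrite patchE; case: (boolP (x \in D)) => [|xD]; last first.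
      by rewrite integral0_eq// => y _; rewrite /e/= indicE (negbTE xD) mulr0 mul0r
        normr0.
    rewrite inE => Dx; rewrite /c muleC -(@ge0_integralZl _ _ _ mu D mD _ _ `|(w1
      x)%:E|%E)//; last first.
      by apply: measurableT_comp => //; exact: (measurable_int _ i2).
    rewrite [leRHS]integral_mkcond; apply: ge0_le_integral => //.
    + by apply: measurableT_comp => //; exact: (measurableT_comp me (pair1_measurable
      _)).
    + exact: (measurable_restrictT _ mD).1 (mw2 x).
    + move=> y _; rewrite patchE; case: (boolP (y \in D)) => [|yD]; last first.
        by rewrite /e/= !indicE (negbTE yD) mulr0 normr0.
      rewrite inE => Dy; rewrite /e/= !indicE !mem_set// !mulr1 lee_fin -normrM.
      by rewrite (le_trans (fw _ _ Dx Dy))// ler_norm.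
rewrite ge0_integralZl//.
- rewrite muleC lte_mul_pinfty//; first exact: integral_ge0.
  by rewrite ge0_fin_numE// integral_ge0.
- by apply: measurableT_comp => //; exact: (measurable_int _ i1).
- exact: integral_ge0.
Qed.

End ProductMeasurability.

(** * Calculus of complex-valued functions *)

Section ComplexCalculus.
Local Open Scope complex_scope.
Context {R : realType}.
Notation mu := (@lebesgue_measure R).
Notation Re := complex.Re.
Notation Im := complex.Im.
Implicit Types (t : R) (z w d : R[i]).

Lemma complex_eqP z w : Re z = Re w -> Im z = Im w -> z = w.
Proof. by case: z => ? ?; case: w => ? ? /= -> ->. Qed.

Lemma cReD z w : Re (z + w) = Re z + Re w. Proof. by case: z; case: w. Qed.
Lemma cImD z w : Im (z + w) = Im z + Im w. Proof. by case: z; case: w. Qed.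
Lemma cReN z : Re (- z) = - Re z. Proof. by case: z. Qed.
Lemma cImN z : Im (- z) = - Im z. Proof. by case: z. Qed.
Lemma cReM z w : Re (z * w) = Re z * Re w - Im z * Im w.
Proof. by case: z; case: w. Qed.
Lemma cImM z w : Im (z * w) = Re z * Im w + Im z * Re w.
Proof. by case: z; case: w. Qed.
Lemma cRe_sum (I : Type) (r : seq I) (P : pred I) (f : I -> R[i]) :
  Re (\sum_(i <- r | P i) f i) = \sum_(i <- r | P i) Re (f i).
Proof. by apply: (big_morph _ cReD). Qed.
Lemma cIm_sum (I : Type) (r : seq I) (P : pred I) (f : I -> R[i]) :
  Im (\sum_(i <- r | P i) f i) = \sum_(i <- r | P i) Im (f i).
Proof. by apply: (big_morph _ cImD). Qed.

(* Submultiplicative, like the modulus, but free of square roots. *)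
Definition cnorm1 z : R := `|Re z| + `|Im z|.

Lemma cnorm1_ge0 z : 0 <= cnorm1 z. Proof. by rewrite addr_ge0. Qed.

Lemma cnorm1D z w : cnorm1 (z + w) <= cnorm1 z + cnorm1 w.
Proof.
rewrite /cnorm1 cReD cImD addrACA.
by rewrite lerD// ler_normD.
Qed.

Lemma cnorm1N z : cnorm1 (- z) = cnorm1 z.
Proof. by rewrite /cnorm1 cReN cImN !normrN. Qed.

Lemma cnorm1M z w : cnorm1 (z * w) <= cnorm1 z * cnorm1 w.
Proof.
rewrite /cnorm1 cReM cImM (@le_trans _ _ ((`|Re z| * `|Re w| + `|Im z| * `|Im w|) +
  (`|Re z| * `|Im w| + `|Im z| * `|Re w|)))//; last by lra.
rewrite lerD// -!normrM ?ler_normD//.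
by rewrite (le_trans (ler_normB _ _)).
Qed.

Lemma cnorm1_sum (I : Type) (r : seq I) (P : pred I) (f : I -> R[i]) :
  cnorm1 (\sum_(i <- r | P i) f i) <= \sum_(i <- r | P i) cnorm1 (f i).
Proof.
elim/big_ind2 : _ => //; first by rewrite /cnorm1/= !normr0 addr0.
by move=> a1 b1 a2 b2 h1 h2; rewrite (le_trans (cnorm1D _ _))// lerD.
Qed.

Lemma cnorm1_normc z : cnorm1 z <= 2 * Normc.normc z.
Proof.
have := normc_ge_Re z; rewrite normc_def lecR.
case: z => a b /= ha.
have hb : `|b| <= Num.sqrt (a ^+ 2 + b ^+ 2).
  by rewrite -sqrtr_sqr ler_wsqrtr// lerDr sqr_ge0.
by rewrite /cnorm1/=; lra.
Qed.

Lemma normc_cnorm1 z : Normc.normc z <= cnorm1 z.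
Proof.
case: z => a b; rewrite /cnorm1/= -[leRHS]ger0_norm ?addr_ge0// -sqrtr_sqr ler_wsqrtr//.
by rewrite sqrrD !real_normK ?num_real// lerD2r lerDl mulrn_wge0// mulr_ge0.
Qed.

(** Each passage from [cnorm1] to the multiplicative modulus costs a factor [2]. The inequality lets
    integrability of a product be read as integrability of the product of the norms. *)
Lemma cnorm1M_ge z w : cnorm1 z * cnorm1 w <= 4 * cnorm1 (z * w).
Proof.
apply: (@le_trans _ _ ((2 * Normc.normc z) * (2 * Normc.normc w))).
  by rewrite ler_pM ?cnorm1_ge0 ?cnorm1_normc.
have -> : 2 * Normc.normc z * (2 * Normc.normc w) = 4 * Normc.normc (z * w).
  by rewrite Normc.normcM; ring.
by rewrite ler_pM2l// normc_cnorm1.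
Qed.

Lemma cnorm1_half : cnorm1 (2^-1 : R[i]) <= 1.
Proof.
have -> : 2^-1 = (2^-1)%:C :> R[i] by rewrite fmorphV rmorph_nat.
rewrite /cnorm1/= normr0 addr0 ger0_norm ?invr_ge0//; lra.
Qed.

Definition is_cderive (g : R -> R[i]) (x : R) d : Prop :=
  is_derive x (1 : R) (fun y => Re (g y)) (Re d) /\
  is_derive x (1 : R) (fun y => Im (g y)) (Im d).

Lemma is_cderiveE (g : R -> R[i]) (x : R) d : is_cderive g x d -> cderive g x 1 = d.
Proof.
move=> [r i]; rewrite /cderive (@derive_val _ _ _ _ _ _ _ r) (@derive_val _ _ _ _ _ _
  _ i).
by case: d r i.
Qed.

Lemma cderivableP (g : R -> R[i]) (x : R) : cderivable g x (1 : R) ->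
  is_cderive g x (cderive g x 1).
Proof. by move=> [r i]; split; apply/derivableP. Qed.

Lemma is_cderive_cst d (x : R) : is_cderive (fun=> d) x 0.
Proof. by split; exact: is_derive_cst. Qed.

Lemma is_cderiveD (g h : R -> R[i]) (x : R) d d' :
  is_cderive g x d -> is_cderive h x d' -> is_cderive (fun y => g y + h y) x (d + d').
Proof.
move=> [gr gi] [hr hi]; split.
  by rewrite cReD; under eq_fun do rewrite cReD; exact: is_deriveD.
by rewrite cImD; under eq_fun do rewrite cImD; exact: is_deriveD.
Qed.

Lemma is_cderive_sum n (g : 'I_n -> R -> R[i]) (x : R) (d : 'I_n -> R[i]) :
  (forall i, is_cderive (g i) x (d i)) ->
  is_cderive (fun y => \sum_(i < n) g i y) x (\sum_(i < n) d i).
Proof.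
move=> dg; split.
  have -> : (fun y => Re (\sum_(i < n) g i y)) = \sum_(i < n) (fun y => Re (g i y)).
    by apply/funext => y; rewrite cRe_sum fct_sumE.
  by rewrite cRe_sum; apply: is_derive_sum => i; exact: (dg i).1.
have -> : (fun y => Im (\sum_(i < n) g i y)) = \sum_(i < n) (fun y => Im (g i y)).
  by apply/funext => y; rewrite cIm_sum fct_sumE.
by rewrite cIm_sum; apply: is_derive_sum => i; exact: (dg i).2.
Qed.

Lemma is_cderiveM (g h : R -> R[i]) (x : R) d d' :
  is_cderive g x d -> is_cderive h x d' ->
  is_cderive (fun y => g y * h y) x (d * h x + g x * d').
Proof.
move=> [gr gi] [hr hi]; split.
  under eq_fun do rewrite cReM.
  apply: (is_derive_eq (is_deriveB (is_deriveM gr hr) (is_deriveM gi hi))).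
  by rewrite cReD !cReM /GRing.scale/=; ring.
under eq_fun do rewrite cImM.
apply: (is_derive_eq (is_deriveD (is_deriveM gr hi) (is_deriveM gi hr))).
by rewrite cImD !cImM /GRing.scale/=; ring.
Qed.

Lemma is_cderive_affine (g : R -> R[i]) (a b x : R) d :
  is_cderive g (a * x + b) d -> is_cderive (fun y => g (a * y + b)) x (a%:C * d).
Proof.
move=> [gr gi].
have dl : is_derive x (1 : R) (fun y => a * y + b) a.
  by apply: is_derive_eq; rewrite /GRing.scale/= mulr1 addr0.
split.
  apply: (is_derive_eq (@is_derive1_comp _ (fun y => Re (g y)) (fun y =>
    a * y + b) _ _ _ gr dl)).
  by rewrite cReM/= mul0r subr0 mulrC.
apply: (is_derive_eq (@is_derive1_comp _ (fun y => Im (g y)) (fun y =>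
  a * y + b) _ _ _ gi dl)).
by rewrite cImM/= mul0r addr0 mulrC.
Qed.

(** The difference quotient of the slice at [t] is the quotient of [g] at [t *: v + x] along [v], so
    differentiability of [g] transfers directly. *)
Lemma is_cderive_slice (V : normedModType R) (g : V -> R[i]) (x v : V) t :
  C1 g -> is_cderive (fun s => g (s *: v + x)) t (cderive g (t *: v + x) v).
Proof.
move=> [dg _]; have [dr di] := dg (t *: v + x).
have slice (f : V -> R) : derivable f (t *: v + x) v ->
    is_derive t (1 : R) (fun s => f (s *: v + x)) ('D_v f (t *: v + x)).
  have E : (fun h : R => h^-1 *: (((fun s : R =>
    f (s *: v + x)) \o shift t) (h *: (1 : R)) - f (t *: v + x))) =
      (fun h : R => h^-1 *: ((f \o shift (t *: v + x)) (h *: v) - f (t *: v + x))).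
    apply/funext => h; rewrite /= !scalerDl [_ *: 1]mulr1 addrA.
    by [].
  by move=> df; split; rewrite /derivable /derive E.
by split; apply: slice; apply: diff_derivable.
Qed.

Lemma C1_continuous (V : normedModType R) (g : V -> R[i]) : C1 g -> ccontinuous g.
Proof. by move=> [dg _]; split=> x; apply: differentiable_continuous; case: (dg x). Qed.

Lemma C1_cderiveD (V : normedModType R) (g : V -> R[i]) (x v w : V) :
  C1 g -> cderive g x (v + w) = cderive g x v + cderive g x w.
Proof.
move=> [dg _]; have [dr di] := dg x.
by rewrite /cderive !deriveE// !linearD.
Qed.

Lemma ccontinuous_cst (V : normedModType R) d : ccontinuous (fun _ : V => d).
Proof. by split=> x; exact: cvg_cst. Qed.

Lemma ccontinuousD (V : normedModType R) (g h : V -> R[i]) :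
  ccontinuous g -> ccontinuous h -> ccontinuous (fun x => g x + h x).
Proof.
move=> [gr gi] [hr hi]; split.
  by under eq_fun do rewrite cReD; move=> x; apply: cvgD; [exact: gr|exact: hr].
by under eq_fun do rewrite cImD; move=> x; apply: cvgD; [exact: gi|exact: hi].
Qed.

Lemma ccontinuousN (V : normedModType R) (g : V -> R[i]) :
  ccontinuous g -> ccontinuous (fun x => - g x).
Proof.
move=> [gr gi]; split.
  by under eq_fun do rewrite cReN; move=> x; apply: cvgN; exact: gr.
by under eq_fun do rewrite cImN; move=> x; apply: cvgN; exact: gi.
Qed.

Lemma ccontinuousM (V : normedModType R) (g h : V -> R[i]) :
  ccontinuous g -> ccontinuous h -> ccontinuous (fun x => g x * h x).
Proof.
move=> [gr gi] [hr hi]; split.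
  under eq_fun do rewrite cReM; move=> x.
  by apply: cvgB; apply: cvgM; by [exact: gr|exact: gi|exact: hr|exact: hi].
under eq_fun do rewrite cImM; move=> x.
by apply: cvgD; apply: cvgM; by [exact: gr|exact: gi|exact: hr|exact: hi].
Qed.

Lemma ccontinuous_sum (V : normedModType R) n (g : 'I_n -> V -> R[i]) :
  (forall i, ccontinuous (g i)) -> ccontinuous (fun x => \sum_(i < n) g i x).
Proof.
move=> cg; elim: n g cg => [|n IH] g cg.
  by under eq_fun do rewrite big_ord0; exact: ccontinuous_cst.
under eq_fun do rewrite big_ord_recr/=.
by apply: ccontinuousD; [exact: IH|exact: cg].
Qed.

Lemma ccontinuous_comp (V W : normedModType R) (f : W -> V) (g : V -> R[i]) :
  ccontinuous g -> continuous f -> ccontinuous (fun x => g (f x)).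
Proof.
move=> [gr gi] cf; split=> x.
  by apply: (@continuous_comp _ _ _ f (fun y => Re (g y))); [exact: cf|exact: gr].
by apply: (@continuous_comp _ _ _ f (fun y => Im (g y))); [exact: cf|exact: gi].
Qed.

Lemma continuous_cnorm1 (g : R -> R[i]) :
  ccontinuous g -> continuous (fun q => cnorm1 (g q)).
Proof.
move=> [gr gi] q; apply: cvgD; [apply: cvg_norm; exact: gr|apply: cvg_norm; exact: gi].
Qed.

Lemma ccontinuous_reflect (g : R -> R[i]) (a : R) : ccontinuous g ->
  ccontinuous (fun q => g (a - q)).
Proof.
move=> cg; apply: (ccontinuous_comp cg) => q.
by apply: cvgB; [exact: cvg_cst|exact: cvg_id].
Qed.

Lemma continuous_shift_pair (a y : R) : continuous (fun q : R => (q + a, y)).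
Proof.
move=> q; apply: (@cvg_pair _ _ _ (nbhs q) (nbhs (q + a)) (nbhs y));
  last exact: cvg_cst.
by apply: cvgD; [exact: cvg_id|exact: cvg_cst].
Qed.

Lemma ccontinuous_shift (G : R -> R -> R[i]) (a y : R) :
  ccontinuous (fun p : R * R => G p.1 p.2) -> ccontinuous (fun q => G (q + a) y).
Proof.
move=> cG; exact: (ccontinuous_comp cG (continuous_shift_pair (a := a) (y := y))).
Qed.

Lemma continuous_pairl (y : R) : continuous (fun x : R => (x, y)).
Proof. by move=> x; apply: (@cvg_pair _ _ _ (nbhs x) (nbhs x) (nbhs y));
  [exact: cvg_id|exact: cvg_cst]. Qed.

Lemma continuous_pairr (x : R) : continuous (fun y : R => (x, y)).
Proof. by move=> y; apply: (@cvg_pair _ _ _ (nbhs y) (nbhs x) (nbhs y));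
  [exact: cvg_cst|exact: cvg_id]. Qed.

Lemma cderive_along_line (V : normedModType R) (g : V -> R[i]) (x v : V) :
  cderive g x v = cderive (fun h : R => g (h *: v + x)) 0 1.
Proof.
have E (p : V -> R) : 'D_v p x = 'D_1 (fun h : R => p (h *: v + x)) (0 : R).
  rewrite /derive; have -> : (fun h : R => h^-1 *: (((fun h : R =>
    p (h *: v + x)) \o shift (0 : R)) (h *: (1 : R)) - p ((0 : R) *: v + x))) =
      (fun h => h^-1 *: ((p \o shift x) (h *: v) - p x)).
    by apply/funext => h; rewrite /= !addr0 [_ *: 1]mulr1 scale0r add0r.
  by [].
by rewrite /cderive !E.
Qed.

Lemma C1_cst (V : normedModType R) (c : R[i]) : C1 (fun _ : V => c).
Proof.
split=> [x|v]; first by split; apply: differentiable_cst.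
have -> : (fun x : V => cderive (fun _ : V => c) x v) = fun=> 0 +i* 0.
  by apply/funext => x; rewrite /cderive !derive_cst.
exact: ccontinuous_cst.
Qed.

End ComplexCalculus.

(** * Integration of complex-valued functions and differentiation under the integral sign *)

Section ComplexIntegral.
Local Open Scope complex_scope.
Context {R : realType}.
Notation mu := (@lebesgue_measure R).
Notation Re := complex.Re.
Notation Im := complex.Im.
Variable D : set R.
Hypothesis mD : measurable (D : set (measurableTypeR R)).
Implicit Types (g h k : R -> R[i]) (w : R -> R) (z c d : R[i]).

Lemma cintegrable_le g w : ccontinuous g -> mu.-integrable D (EFin \o w) ->
  (forall q, D q -> cnorm1 (g q) <= w q) -> cintegrable D g.
Proof.
move=> [gr gi] iw gw; split; apply: (@le_integrable _ _ _ mu D mD _ _ _ _ iw).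
- by apply/measurable_EFinP; exact: measurable_funS (continuous_measurable_fun gr).
- move=> q Dq; rewrite lee_fin (le_trans _ (ler_norm _))// (le_trans _ (gw q Dq))//.
  by rewrite lerDl.
- by apply/measurable_EFinP; exact: measurable_funS (continuous_measurable_fun gi).
- move=> q Dq; rewrite lee_fin (le_trans _ (ler_norm _))// (le_trans _ (gw q Dq))//.
  by rewrite lerDr.
Qed.

Lemma integrable_cnorm1 g : cintegrable D g ->
  mu.-integrable D (EFin \o (fun q => cnorm1 (g q))).
Proof.
move=> [ir ii]; apply: (@integrableD _ _ _ mu D mD
  (EFin \o (fun q => `|Re (g q)|)) (EFin \o (fun q => `|Im (g q)|))).
  exact: (@integrable_norm _ _ _ mu D _ ir).
exact: (@integrable_norm _ _ _ mu D _ ii).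
Qed.

Lemma integrableZl_fin w (a : R) : mu.-integrable D (EFin \o w) ->
  mu.-integrable D (EFin \o (fun q => a * w q)).
Proof.
move=> iw; exact: (@integrableZl _ _ _ mu D mD a _ iw).
Qed.

Lemma integrableD_fin w w' : mu.-integrable D (EFin \o w) ->
  mu.-integrable D (EFin \o w') -> mu.-integrable D (EFin \o (fun q => w q + w' q)).
Proof.
move=> iw iw'; exact: (@integrableD _ _ _ mu D mD _ _ iw iw').
Qed.

Lemma integrable_sum_fin n (w : 'I_n -> R -> R) :
  (forall i, mu.-integrable D (EFin \o w i)) ->
  mu.-integrable D (EFin \o (fun q => \sum_(i < n) w i q)).
Proof.
move=> iw; apply: (@eq_integrable _ _ _ mu D mD (fun q => \sum_(i < n) (w i q)%:E)%E).
  by move=> q _; rewrite /= sumEFin.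
by apply: (@integrable_sum _ _ _ mu D mD) => i _; exact: iw.
Qed.

Lemma cintegrable_mulb k h (M : R) : ccontinuous k -> ccontinuous h ->
  cintegrable D k -> (forall q, D q -> cnorm1 (h q) <= M) ->
  cintegrable D (fun q => k q * h q).
Proof.
move=> ck ch ik hM; apply: (@cintegrable_le _ (fun q => M * cnorm1 (k q))).
- exact: ccontinuousM.
- by apply: integrableZl_fin; exact: integrable_cnorm1.
- move=> q Dq; rewrite (le_trans (cnorm1M _ _))// mulrC ler_wpM2r ?cnorm1_ge0//.
  exact: hM.
Qed.

Lemma cintegrableD g h : cintegrable D g -> cintegrable D h ->
  cintegrable D (fun q => g q + h q).
Proof.
move=> [gr gi] [hr hi]; split.
  by under eq_fun do rewrite cReD; exact: integrableD_fin.
by under eq_fun do rewrite cImD; exact: integrableD_fin.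
Qed.

Lemma cintegrableZl g c : cintegrable D g -> cintegrable D (fun q => c * g q).
Proof.
move=> [gr gi]; split.
  under eq_fun do rewrite cReM -mulNr.
  by apply: integrableD_fin; exact: integrableZl_fin.
under eq_fun do rewrite cImM.
by apply: integrableD_fin; exact: integrableZl_fin.
Qed.

Lemma cintegrable_sum n (g : 'I_n -> R -> R[i]) :
  (forall i, cintegrable D (g i)) -> cintegrable D (fun q => \sum_(i < n) g i q).
Proof.
move=> ig; split.
  under eq_fun do rewrite cRe_sum.
  by apply: integrable_sum_fin => i; exact: (ig i).1.
under eq_fun do rewrite cIm_sum.
by apply: integrable_sum_fin => i; exact: (ig i).2.
Qed.

Lemma eq_cintegrable g h : (forall q, D q -> g q = h q) ->
  cintegrable D g -> cintegrable D h.
Proof.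
move=> gh [ir ii]; split.
  by apply: (@eq_integrable _ _ _ mu D mD _ _ _ ir) => q; rewrite inE => Dq; rewrite gh.
by apply: (@eq_integrable _ _ _ mu D mD _ _ _ ii) => q; rewrite inE => Dq; rewrite gh.
Qed.

Lemma eq_cintegral g h : (forall q, D q -> g q = h q) ->
  cintegral D g = cintegral D h.
Proof.
by move=> gh; congr (_ +i* _); apply: eq_Rintegral => q; rewrite inE => Dq; rewrite gh.
Qed.

Lemma cintegralD g h : cintegrable D g -> cintegrable D h ->
  cintegral D (fun q => g q + h q) = cintegral D g + cintegral D h.
Proof.
move=> [gr gi] [hr hi]; rewrite /cintegral; apply: complex_eqP => /=.
  by under eq_Rintegral do rewrite cReD; rewrite (@RintegralD _ _ _ mu D _ _ mD gr hr).
by under eq_Rintegral do rewrite cImD; rewrite (@RintegralD _ _ _ mu D _ _ mD gi hi).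
Qed.

Lemma cintegralZl g c : cintegrable D g ->
  cintegral D (fun q => c * g q) = c * cintegral D g.
Proof.
move=> [gr gi]; rewrite /cintegral; apply: complex_eqP => /=.
  under eq_Rintegral do rewrite cReM.
  rewrite (@RintegralB _ _ _ mu D _ _ mD); [|exact: integrableZl_fin..].
  by rewrite !(@RintegralZl _ _ _ mu D _ _ mD)// cReM.
under eq_Rintegral do rewrite cImM.
rewrite (@RintegralD _ _ _ mu D _ _ mD); [|exact: integrableZl_fin..].
by rewrite !(@RintegralZl _ _ _ mu D _ _ mD)// cImM.
Qed.

(* Divergent integrals have finite part [0], hence no side condition. *)
Lemma RintegralN (f : R -> R) :
  \int[mu]_(q in D) (- f q) = - \int[mu]_(q in D) f q.
Proof.
rewrite /Rintegral; under eq_integral do rewrite EFinN.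
rewrite [in LHS](integralE mu D) funeposN funenegN [in RHS](integralE mu D).
move: (\int[mu]_(x in D) _)%E (\int[mu]_(x in D) _)%E => a b.
by case: a => [a| |]; case: b => [b| |] //=; rewrite ?oppr0// opprB.
Qed.

Lemma cintegralN g : cintegral D (fun q => - g q) = - cintegral D g.
Proof.
rewrite /cintegral; apply: complex_eqP => /=.
  by under eq_Rintegral do rewrite cReN; exact: RintegralN.
by under eq_Rintegral do rewrite cImN; exact: RintegralN.
Qed.

Lemma cintegral0 : cintegral D (fun=> 0) = 0.
Proof.
by rewrite /cintegral; apply: complex_eqP; rewrite /= Rintegral_cst//= mul0r.
Qed.

Lemma cintegral_sum n (g : 'I_n -> R -> R[i]) :
  (forall i, cintegrable D (g i)) ->
  cintegral D (fun q => \sum_(i < n) g i q) = \sum_(i < n) cintegral D (g i).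
Proof.
elim: n g => [|n IH] g ig.
  by rewrite big_ord0 -[RHS]cintegral0; apply: eq_cintegral => q _; rewrite big_ord0.
rewrite big_ord_recr/= -IH// -cintegralD//; last by apply: cintegrable_sum.
by apply: eq_cintegral => q _; rewrite big_ord_recr.
Qed.

Lemma cintegral_exchange (f : R * R -> R[i]) w w' :
  ccontinuous f ->
  mu.-integrable D (EFin \o w) -> mu.-integrable D (EFin \o w') ->
  (forall x y, D x -> D y -> cnorm1 (f (x, y)) <= w x * w' y) ->
  cintegral D (fun x => cintegral D (fun y => f (x, y))) =
  cintegral D (fun y => cintegral D (fun x => f (x, y))).
Proof.
move=> [fr fi] iw iw' fw; apply: complex_eqP => /=.
  apply: (@Rintegral_exchange _ (fun p => Re (f p)) w w' D mD fr iw iw').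
  by move=> x y Dx Dy; rewrite (le_trans _ (fw _ _ Dx Dy))// lerDl.
apply: (@Rintegral_exchange _ (fun p => Im (f p)) w w' D mD fi iw iw').
by move=> x y Dx Dy; rewrite (le_trans _ (fw _ _ Dx Dy))// lerDr.
Qed.

Lemma is_derive_under_Rintegral (H H' : R -> R -> R) w (a e : R) : 0 < e ->
  (forall t, `|t - a| < e -> mu.-integrable D (EFin \o H t)) ->
  (forall t q, `|t - a| < e -> D q -> is_derive t (1 : R) (H^~ q) (H' t q)) ->
  mu.-integrable D (EFin \o w) ->
  (forall t q, `|t - a| < e -> D q -> `|H' t q| <= w q) ->
  is_derive a (1 : R) (fun t => \int[mu]_(q in D) H t q) (\int[mu]_(q in D) H' a q).
Proof.
move=> e0 iH dH iw Hw.
have I t : `](a - e), (a + e)[%classic t -> `|t - a| < e.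
  by rewrite /= in_itv/= ltr_norml => /andP[? ?]; lra.
have Ia : `](a - e), (a + e)[%classic a by rewrite /= in_itv/=; lra.
have d1 t q : `|t - a| < e -> D q -> partial1of2 H t q = H' t q.
  by move=> ta Dq; rewrite partial1of2E; exact: (@derive_val _ _ _ _ _ _ _ (dH _ _ ta
    Dq)).
have := @cvg_differentiation_under_integral R _ _ mu H D mD a _ _ Ia
  (fun t It => iH t (I t It))
  (fun t q It Dq => @ex_derive _ _ _ _ _ _ _ (dH t q (I t It) Dq))
  (fun q => `|w q|) (fun q => normr_ge0 _) (@integrable_norm _ _ _ mu D _ iw).
have B t q : `](a - e), (a + e)[%classic t -> D q -> `|partial1of2 H t q| <= `|w q|.
  move=> /I ta Dq; rewrite d1//.
  by rewrite (le_trans (Hw _ _ ta Dq))// ler_norm.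
move=> /(_ B).
have -> : \int[mu]_(q in D) partial1of2 H a q = \int[mu]_(q in D) H' a q.
  by apply: eq_Rintegral => q; rewrite inE => Dq; rewrite d1// subrr normr0.
move=> C; split.
  apply/cvg_ex; exists (\int[mu]_(q in D) H' a q).
  by under eq_fun do rewrite /= [_ *: 1]mulr1.
apply/cvg_lim => //.
by under eq_fun do rewrite /= [_ *: 1]mulr1.
Qed.

Lemma is_cderive_under_cintegral (H H' : R -> R -> R[i]) w (a e : R) : 0 < e ->
  (forall t, `|t - a| < e -> cintegrable D (H t)) ->
  (forall t q, `|t - a| < e -> D q -> is_cderive (H^~ q) t (H' t q)) ->
  mu.-integrable D (EFin \o w) ->
  (forall t q, `|t - a| < e -> D q -> cnorm1 (H' t q) <= w q) ->
  is_cderive (fun t => cintegral D (H t)) a (cintegral D (H' a)).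
Proof.
move=> e0 iH dH iw Hw; split.
  apply: (@is_derive_under_Rintegral (fun t q => Re (H t q)) (fun t q =>
    Re (H' t q)) w a e) => //.
  - by move=> t /iH[].
  - by move=> t q ta /(dH _ _ ta)[].
  - by move=> t q ta Dq; rewrite (le_trans _ (Hw _ _ ta Dq))// lerDl.
apply: (@is_derive_under_Rintegral (fun t q => Im (H t q)) (fun t q =>
  Im (H' t q)) w a e) => //.
- by move=> t /iH[].
- by move=> t q ta /(dH _ _ ta)[].
- by move=> t q ta Dq; rewrite (le_trans _ (Hw _ _ ta Dq))// lerDr.
Qed.

End ComplexIntegral.

Lemma cintegral_derive_itvcy {R : realType} (G g : R -> R[i]) (s : R) :
  (forall x, is_cderive G x (g x)) -> ccontinuous g ->
  cintegrable `[s, +oo[ G -> cintegrable `[s, +oo[ g ->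
  cintegral `[s, +oo[ g = - G s.
Proof.
move=> dG [gr gi] [Gri Gii] [gri gii]; apply: complex_eqP; rewrite ?cReN ?cImN /=.
  exact: (Rintegral_derive_itvcy (fun x => (dG x).1)).
exact: (Rintegral_derive_itvcy (fun x => (dG x).2)).
Qed.

(** * Resolvents of antisymmetric kernels *)

Section AntisymmetricKernel.
Local Open Scope complex_scope.
Context {R : realType}.
Notation mu := (@lebesgue_measure R).

Lemma cnorm1_cintegral (D : set R) (mD : measurable (D : set (measurableTypeR R)))
    (g : R -> R[i]) (w : R -> R) :
  cintegrable D g -> mu.-integrable D (EFin \o w) ->
  (forall q, D q -> cnorm1 (g q) <= w q) ->
  cnorm1 (cintegral D g) <= \int[mu]_(q in D) w q.
Proof.
move=> ig iw gw; have [ir ii] := ig.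
have nr := @integrable_norm _ _ _ mu D _ ir.
have ni := @integrable_norm _ _ _ mu D _ ii.
apply: (@le_trans _ _ (\int[mu]_(q in D) cnorm1 (g q))).
  rewrite (@RintegralD _ _ _ mu D _ _ mD nr ni) lerD//.
    exact: (@le_normr_Rintegral _ _ _ mu D _ mD ir).
  exact: (@le_normr_Rintegral _ _ _ mu D _ mD ii).
by apply: (@le_Rintegral _ _ _ mu D _ _ mD) => //; exact: integrable_cnorm1.
Qed.

Context {N : nat} (s : R).
Notation D := (`[s, +oo[%classic : set R).

Let mD : measurable (D : set (measurableTypeR R)).
Proof. exact: measurable_itv. Qed.

Context (C : 'I_N -> 'I_N -> R * R -> R[i]) (W : 'I_N -> R -> R).
Hypothesis cC : forall l m, ccontinuous (C l m).
Hypothesis antiC : forall l m x y, C l m (x, y) = - C m l (y, x).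
Hypothesis CW : forall l m x y, D x -> D y -> cnorm1 (C l m (x, y)) <= W m y.

(* In the application [a] is the [i]-th row of [K], so that [E] is the [i]-th
   row of [(1 + K) C]. *)
Definition resolvent_form (i : 'I_N) (a E : 'I_N -> R -> R[i]) :=
  forall m y, E m y = C i m (s, y) + cintegral D (fun q => \sum_l a l q * C l m (q, y)).

(** [W m] bounds column [m] of the kernel uniformly in the row variable, so [W m q * cnorm1 (a m q)]
    dominates a kernel column multiplied by the row; [C] itself need not decay. *)
Definition admissible_row (a : 'I_N -> R -> R[i]) :=
  forall m, [/\ ccontinuous (a m), cintegrable D (a m) &
    mu.-integrable D (EFin \o (fun q => W m q * cnorm1 (a m q)))].

Lemma cintegrable_rowC a m y : admissible_row a -> D y ->
  cintegrable D (fun q => \sum_l a l q * C l m (q, y)).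
Proof.
move=> ha Dy; apply: (cintegrable_sum mD) => l; have [ca ia _] := ha l.
apply: (cintegrable_mulb mD (M := W m y)) => //.
  exact: (ccontinuous_comp (cC l m) (continuous_pairl (y := y))).
by move=> q Dq; exact: CW.
Qed.

(** The resolvent form of [E] is inserted under the integral against [b]. The integrability clause
    is what later allows two such integrals to be merged into that of a total derivative. *)
Lemma row_form_integrals i a E b : admissible_row a -> admissible_row b ->
  (forall m, ccontinuous (E m)) -> resolvent_form i a E ->
  cintegrable D (fun y => \sum_m E m y * b m y) /\
  cintegral D (fun y => \sum_m E m y * b m y) =
  cintegral D (fun y => \sum_m C i m (s, y) * b m y) +
  cintegral D (fun y => cintegral D (fun x =>
     \sum_m (\sum_l a l x * C l m (x, y)) * b m y)).
Proof.
move=> ha hb cE eE.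
pose S x := \sum_l cnorm1 (a l x).
have iS : mu.-integrable D (EFin \o S).
  by apply: (integrable_sum_fin mD) => l; have [_ ia _] := ha l;
    exact: integrable_cnorm1.
have Ds : D s by rewrite /= in_itv/= lexx.
have iCb : cintegrable D (fun y => \sum_m C i m (s, y) * b m y).
  apply: (cintegrable_sum mD) => m; have [cb ib Wb] := hb m.
  apply: (cintegrable_le mD _ Wb).
    by apply: ccontinuousM => //; exact: (ccontinuous_comp (cC i m) (continuous_pairr
      (x := s))).
  move=> q Dq; rewrite (le_trans (cnorm1M _ _))// ler_wpM2r ?cnorm1_ge0//.
  exact: CW.
(* Writing the inner integral as [E m y - C i m (s, y)] gives its continuity in [y] from that of
   [E], with no study of integrals depending on a parameter. *)
have iIb : cintegrable D (fun y => \sum_m (E m y - C i m (s, y)) * b m y).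
  apply: (cintegrable_sum mD) => m; have [cb ib Wb] := hb m.
  apply: (cintegrable_le mD _ (integrableZl_fin mD (\int[mu]_(x in D) S x) Wb)).
    apply: ccontinuousM => //; apply: ccontinuousD => //; apply: ccontinuousN.
    exact: (ccontinuous_comp (cC i m) (continuous_pairr (x := s))).
  move=> q Dq; rewrite mulrA (le_trans (cnorm1M _ _))// ler_wpM2r ?cnorm1_ge0//.
  rewrite eE addrC addKr mulrC -(@RintegralZl _ _ _ mu D _ _ mD iS).
  apply: (cnorm1_cintegral mD) => //.
  - exact: cintegrable_rowC.
  - exact: (integrableZl_fin mD).
  - move=> x Dx; rewrite (le_trans (cnorm1_sum _ _ _))// mulr_sumr ler_sum// => l _.
    by rewrite (le_trans (cnorm1M _ _))// mulrC ler_wpM2r ?cnorm1_ge0// CW.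
have eEb y : \sum_m E m y * b m y =
    \sum_m C i m (s, y) * b m y + \sum_m (E m y - C i m (s, y)) * b m y.
  by rewrite -big_split/=; apply: eq_bigr => m _; rewrite -mulrDl addrC subrK.
split.
  apply: (eq_cintegrable mD _ (cintegrableD mD iCb iIb)).
  by move=> y _; rewrite -eEb.
rewrite (eq_cintegral (fun y _ => eEb y)) (cintegralD mD)//; congr (_ + _).
apply: eq_cintegral => y Dy.
transitivity (\sum_m b m y * cintegral D (fun q => \sum_l a l q * C l m (q, y))).
  by apply: eq_bigr => m _; rewrite eE addrC addKr mulrC.
transitivity (\sum_m cintegral D (fun x => b m y * \sum_l a l x * C l m (x, y))).
  by apply: eq_bigr => m _; rewrite (cintegralZl mD)//; exact: cintegrable_rowC.
rewrite -(cintegral_sum mD).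
  by apply: eq_cintegral => x _; apply: eq_bigr => m _; rewrite mulrC.
by move=> m; apply: (cintegrableZl mD); exact: cintegrable_rowC.
Qed.

(* [(1 + K) C (1 + K)^T] is antisymmetric when [C] is. *)
Lemma antisymmetric_form i j a b E E' : admissible_row a -> admissible_row b ->
  (forall m, ccontinuous (E m)) -> (forall m, ccontinuous (E' m)) ->
  resolvent_form i a E -> resolvent_form j b E' ->
  E j s + E' i s + (cintegral D (fun y => \sum_m E m y * b m y) +
    cintegral D (fun y => \sum_m E' m y * a m y)) = 0.
Proof.
move=> ha hb cE cE' eE eE'.
have [_ ->] := row_form_integrals ha hb cE eE.
have [_ ->] := row_form_integrals hb ha cE' eE'.
have Ds : D s by rewrite /= in_itv/= lexx.
(* By antisymmetry these single integrals cancel the integral parts of [E j s] and [E' i s]; the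
   free terms [C i j (s, s)] and [C j i (s, s)] cancel each other, leaving only the two double
   integrals. *)
have swap p c : admissible_row c -> cintegral D (fun y => \sum_m C p m (s, y) * c m y) =
    - cintegral D (fun q => \sum_l c l q * C l p (q, s)).
  move=> hc; rewrite -cintegralN.
  apply: eq_cintegral => y _; rewrite -sumrN; apply: eq_bigr => m _.
  by rewrite antiC mulNr mulrC.
rewrite eE eE' !swap// (antiC i j).
pose f (p : R * R) := \sum_m (\sum_l a l p.1 * C l m p) * b m p.2.
have cf : ccontinuous f.
  apply: ccontinuous_sum => m; have [cb _ _] := hb m; apply: ccontinuousM.
    apply: ccontinuous_sum => l; have [ca _ _] := ha l; apply: ccontinuousM => //.
    by apply: (ccontinuous_comp ca) => p; exact: cvg_fst.
  by apply: (ccontinuous_comp cb) => p; exact: cvg_snd.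
have exch : cintegral D (fun x => cintegral D (fun y => f (x, y))) =
    cintegral D (fun y => cintegral D (fun x => f (x, y))).
  apply: (@cintegral_exchange _ D mD f (fun x => \sum_l cnorm1 (a l x))
    (fun y => \sum_m W m y * cnorm1 (b m y))) => //.
  - by apply: (integrable_sum_fin mD) => l; have [_ ia _] := ha l;
    exact: integrable_cnorm1.
  - by apply: (integrable_sum_fin mD) => m; have [_ _] := hb m.
  - move=> x y Dx Dy; rewrite (le_trans (cnorm1_sum _ _ _))// mulr_sumr ler_sum// =>
    m _.
    rewrite (le_trans (cnorm1M _ _))//= mulrA ler_wpM2r ?cnorm1_ge0//.
    rewrite (le_trans (cnorm1_sum _ _ _))// mulr_suml ler_sum// => l _.
    rewrite (le_trans (cnorm1M _ _))//= ler_wpM2l ?cnorm1_ge0//.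
    exact: CW.
(* Antisymmetry turns the second double integral into minus the first one taken in the other order,
   which is why the exchange [exch] is required. *)
have -> : cintegral D (fun y => cintegral D (fun x =>
     \sum_m (\sum_l b l x * C l m (x, y)) * a m y)) =
    - cintegral D (fun y => cintegral D (fun x => f (x, y))).
  rewrite -exch -cintegralN; apply: eq_cintegral => y _.
  rewrite -cintegralN; apply: eq_cintegral => x _.
  rewrite /f/= -sumrN; under eq_bigr do rewrite mulr_suml.
  rewrite exchange_big/=; apply: eq_bigr => m _.
  rewrite mulr_suml -sumrN; apply: eq_bigr => l _.
  by rewrite antiC mulrN mulNr; congr (- _); ring.
rewrite /f/=; ring.
Qed.

(** The half in [EA] and [EB] makes [E m * b m + E' m * a m] the derivative of [phi m * a m * b m].
    The integrals in [antisymmetric_form] thus reduce to minus the value of that sum at [s]. *)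
Lemma antisymmetric_weighted_identity i j a b A B E E'
    (phi phi' : 'I_N -> R -> R[i]) (M : R) :
  admissible_row a -> admissible_row b ->
  (forall m, ccontinuous (E m)) -> (forall m, ccontinuous (E' m)) ->
  resolvent_form i a E -> resolvent_form j b E' ->
  (forall m q, is_cderive (a m) q (A m q)) ->
  (forall m q, is_cderive (b m) q (B m q)) ->
  (forall m q, is_cderive (phi m) q (phi' m q)) ->
  (forall m q, E m q = phi m q * A m q + 2^-1 * phi' m q * a m q) ->
  (forall m q, E' m q = phi m q * B m q + 2^-1 * phi' m q * b m q) ->
  (forall m, ccontinuous (phi m)) ->
  (forall m q, D q -> cnorm1 (phi m q) <= W m q) ->
  (forall m q, D q -> cnorm1 (a m q) <= M) ->
  E j s + E' i s = \sum_m phi m s * a m s * b m s.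
Proof.
move=> ha hb cE cE' eE eE' dA dB dphi EA EB cphi phiW aM.
have := antisymmetric_form ha hb cE cE' eE eE'.
have [iE _] := row_form_integrals ha hb cE eE.
have [iE' _] := row_form_integrals hb ha cE' eE'.
rewrite -(cintegralD mD iE iE').
rewrite (@cintegral_derive_itvcy _ (fun q => \sum_m phi m q * a m q * b m q)).
- by move/eqP; rewrite subr_eq0 => /eqP.
- move=> q; rewrite -big_split/=; apply: is_cderive_sum => m.
  have -> : E m q * b m q + E' m q * a m q =
      (phi' m q * a m q + phi m q * A m q) * b m q + phi m q * a m q * B m q.
    have half : 2^-1 + 2^-1 = 1 :> R[i] by field.
    rewrite EA EB; transitivity ((2^-1 + 2^-1) * phi' m q * a m q * b m q + phi m q *
      A m q * b m q + phi m q * a m q * B m q); first by ring.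
    by rewrite half; ring.
  by apply: is_cderiveM => //; apply: is_cderiveM.
- by apply: ccontinuousD; apply: ccontinuous_sum => m; apply: ccontinuousM => //;
  [have [] := hb m|have [] := ha m].
(* The primitive must be integrable for its value at infinity to vanish: [M] bounds [a], [W] bounds
   [phi], and [W m * cnorm1 (b m)] is integrable by admissibility. *)
- apply: (cintegrable_sum mD) => m; have [ca ia Wa] := ha m; have [cb ib Wb] := hb m.
  apply: (cintegrable_le mD _ (integrableZl_fin mD M Wb)).
    by do 2 apply: ccontinuousM => //.
  move=> q Dq; rewrite mulrA (le_trans (cnorm1M _ _))// ler_wpM2r ?cnorm1_ge0//.
  rewrite (le_trans (cnorm1M _ _))// mulrC ler_pM ?cnorm1_ge0//;
    [exact: aM|exact: phiW].
- exact: (cintegrableD mD).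
Qed.

End AntisymmetricKernel.

(** * The dressing equation *)

Section DressingCalculus.
Local Open Scope complex_scope.
Context {R : realType} {N : nat}.
Notation mu := (@lebesgue_measure R).
Context (F : 'I_N -> 'I_N -> R -> R -> R[i]).
Context (K : 'I_N -> 'I_N -> R -> R -> 'rV[R]_N -> R[i]).
Hypothesis F_reg : regular_dressing F.
Hypothesis K_reg : regular_kernel K.
Implicit Types (i j k l : 'I_N) (s t q x y : R) (u v : 'rV[R]_N).

Definition F1 i j x y : R[i] := cderive (fun p : R * R => F i j p.1 p.2) (x, y) (1, 0).
Definition F2 i j x y : R[i] := cderive (fun p : R * R => F i j p.1 p.2) (x, y) (0, 1).

Lemma F_C1 i j : C1 (fun p : R * R => F i j p.1 p.2).
Proof. by have [] := F_reg i j. Qed.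

Lemma is_cderive_F1 i j x y : is_cderive (fun x' => F i j x' y) x (F1 i j x y).
Proof.
have E t : t *: ((1, 0) : R * R) + (0, y) = (t, y).
  by apply/pair_eqP; rewrite /= scaler0 add0r addr0 [_ *: 1]mulr1 !eqxx.
have := is_cderive_slice ((0, y) : R * R) ((1, 0) : R * R) x (F_C1 i j).
by rewrite E; under eq_fun do rewrite E.
Qed.

Lemma is_cderive_F2 i j x y : is_cderive (fun y' => F i j x y') y (F2 i j x y).
Proof.
have E t : t *: ((0, 1) : R * R) + (x, 0) = (x, t).
  by apply/pair_eqP; rewrite /= scaler0 add0r addr0 [_ *: 1]mulr1 !eqxx.
have := is_cderive_slice ((x, 0) : R * R) ((0, 1) : R * R) y (F_C1 i j).
by rewrite E; under eq_fun do rewrite E.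
Qed.

Lemma ccontinuous_F i j : ccontinuous (fun p : R * R => F i j p.1 p.2).
Proof. exact: C1_continuous (F_C1 i j). Qed.

Lemma ccontinuous_F1 i j : ccontinuous (fun p : R * R => F1 i j p.1 p.2).
Proof.
have [_ /(_ (1, 0))] := F_C1 i j; rewrite /F1.
by have -> : cderive (fun p => F i j p.1 p.2) ^~ (1, 0) = fun p =>
  cderive (fun p : R * R => F i j p.1 p.2) (p.1, p.2) (1, 0) by apply/funext => -[].
Qed.

Lemma ccontinuous_F2 i j : ccontinuous (fun p : R * R => F2 i j p.1 p.2).
Proof.
have [_ /(_ (0, 1))] := F_C1 i j; rewrite /F2.
by have -> : cderive (fun p => F i j p.1 p.2) ^~ (0, 1) = fun p =>
  cderive (fun p : R * R => F i j p.1 p.2) (p.1, p.2) (0, 1) by apply/funext => -[].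
Qed.

Lemma uniform_quadrant_bound (G : 'I_N -> 'I_N -> R * R -> R[i]) (a : R) :
  (forall i j, bounded_on_quadrants (G i j)) ->
  exists M : R, forall i j x y, a <= x -> a <= y -> cnorm1 (G i j (x, y)) <= M.
Proof.
move=> bG; have /choice[M HM] : forall p : 'I_N * 'I_N, exists M : R,
    forall x y, a <= x -> a <= y -> Normc.normc (G p.1 p.2 (x, y)) <= M.
  by move=> p; exact: bG.
exists (\sum_p 2 * `|M p|) => i j x y ax ay.
rewrite (le_trans (cnorm1_normc _))// (bigD1 (i, j))//= ler_wpDr ?sumr_ge0//.
by rewrite ler_pM2l// (le_trans (HM (i, j) _ _ ax ay))// ler_norm.
Qed.

(** The clause [1 <= M] allows the kernel bound built from [M] to dominate also the bare weight
    [f m] in [weighted_identity]. *)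
Lemma F_bounded (a : R) : exists M : R, 1 <= M /\
  forall i j x y, a <= x -> a <= y ->
  [/\ cnorm1 (F i j x y) <= M, cnorm1 (F1 i j x y) <= M & cnorm1 (F2 i j x y) <= M].
Proof.
have [M0 h0] := @uniform_quadrant_bound (fun i j p => F i j p.1 p.2) a
  (fun i j => let: And3 _ h _ := F_reg i j in h).
have [M1 h1] := @uniform_quadrant_bound (fun i j p => F1 i j p.1 p.2) a
  (fun i j a => let: And3 _ _ h := F_reg i j in h (1, 0) a).
have [M2 h2] := @uniform_quadrant_bound (fun i j p => F2 i j p.1 p.2) a
  (fun i j a => let: And3 _ _ h := F_reg i j in h (0, 1) a).
exists (1 + `|M0| + `|M1| + `|M2|); split.
  by rewrite -!addrA lerDl !addr_ge0.
move=> i j x y ax ay; split.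
- apply: le_trans (h0 i j x y ax ay) _; rewrite (le_trans (ler_norm _))//.
  by rewrite -!addrA addrCA lerDl !addr_ge0.
- apply: le_trans (h1 i j x y ax ay) _; rewrite (le_trans (ler_norm _))//.
  by rewrite addrAC lerDr !addr_ge0.
- apply: le_trans (h2 i j x y ax ay) _; rewrite (le_trans (ler_norm _))//.
  by rewrite lerDr !addr_ge0.
Qed.

(* [Kq] and [Ku k] are the partial derivatives of [K i j s q u] in [q] and in
   the coordinate [u 0 k]. *)
Definition Kfun i j (p : R * R * 'rV[R]_N) := K i j p.1.1 p.1.2 p.2.
Definition Kq i j s q u : R[i] := cderive (Kfun i j) (s, q, u) (0, 1, 0).
Definition Ku k i j s q u : R[i] := cderive (Kfun i j) (s, q, u) (0, 0, delta_mx 0 k).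

Lemma K_C1 i j : C1 (Kfun i j). Proof. by have [] := K_reg i j. Qed.

(** Letting the second argument move at speed [c] along with [u] covers the partial derivatives and
    the mixed direction of [Kdir] in one statement. *)
Lemma is_cderive_Kpath i j s q u v (c t : R) :
  is_cderive (fun h : R => K i j s (h * c + q) (h *: v + u)) t
    (cderive (Kfun i j) (s, t * c + q, t *: v + u) (0, c, v)).
Proof.
have E (h : R) : h *: ((0, c, v) : R * R * 'rV[R]_N) + (s, q, u) = (s, h * c + q, h
  *: v + u).
  by transitivity ((h * 0 + s, h * c + q, h *: v + u)); rewrite // mulr0 add0r.
have := is_cderive_slice ((s, q, u) : R * R * 'rV[R]_N) ((0, c, v) : R * R *
  'rV[R]_N) t (K_C1 i j).
by rewrite E; under eq_fun do rewrite E.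
Qed.

Lemma is_cderive_Kq i j s q u : is_cderive (fun t => K i j s t u) q (Kq i j s q u).
Proof.
have := is_cderive_Kpath i j s 0 u 0 1 q.
rewrite scaler0 mulr1 !addr0 add0r.
by under eq_fun do rewrite scaler0 mulr1 addr0 add0r.
Qed.

Lemma is_cderive_Ku k i j s q u (t : R) :
  is_cderive (fun h : R => K i j s q (h *: delta_mx 0 k + u)) t
    (Ku k i j s q (t *: delta_mx 0 k + u)).
Proof.
have := is_cderive_Kpath i j s q u (delta_mx 0 k) 0 t.
by rewrite mulr0 add0r; under eq_fun do rewrite mulr0 add0r.
Qed.

Lemma cderive_Kfun k i j s q u (c : bool) :
  cderive (Kfun i j) (s, q, u) (0, c%:R, delta_mx 0 k) =
  Ku k i j s q u + c%:R * Kq i j s q u.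
Proof.
case: c; rewrite ?mul0r ?mul1r ?addr0// /Ku /Kq -C1_cderiveD; last exact: K_C1.
by congr cderive; transitivity ((0 + 0, 0 + 1, delta_mx 0 k + 0) : R * R * 'rV[R]_N);
  rewrite // !add0r addr0.
Qed.

Lemma continuous_Kslice s u : continuous (fun q : R => (s, q, u) : R * R * 'rV[R]_N).
Proof.
move=> q; apply: (@cvg_pair _ _ _ (nbhs q) (nbhs (s, q)) (nbhs u)); last exact: cvg_cst.
exact: continuous_pairr.
Qed.

Lemma ccontinuous_K i j s u : ccontinuous (fun q => K i j s q u).
Proof. exact: (ccontinuous_comp (C1_continuous (K_C1 i j)) (continuous_Kslice (s :=
  s) (u := u))). Qed.

Lemma ccontinuous_Kq i j s u : ccontinuous (fun q => Kq i j s q u).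
Proof. exact: (ccontinuous_comp ((K_C1 i j).2 _) (continuous_Kslice (s := s) (u :=
  u))). Qed.

Lemma ccontinuous_Ku k i j s u : ccontinuous (fun q => Ku k i j s q u).
Proof. exact: (ccontinuous_comp ((K_C1 i j).2 _) (continuous_Kslice (s := s) (u :=
  u))). Qed.

Lemma locally_dominated_path (g : R * R * 'rV[R]_N -> R[i]) s u v :
  locally_dominated g -> exists (e : R) (w : R -> R),
  [/\ 0 < e, mu.-integrable `[s, +oo[ (EFin \o w) &
  forall h q : R, `|h| < e -> s <= q -> cnorm1 (g (s, q, h *: v + u)) <= w q].
Proof.
move=> /(_ s u)[a [w [as0 iw gw]]].
have cp : (s, h *: v + u) @[h --> (0 : R)] --> (s, u).
  apply: (@cvg_pair _ _ _ (nbhs (0 : R)) (nbhs s) (nbhs u)); first exact: cvg_cst.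
  have : h *: v + u @[h --> (0 : R)] --> 0 *: v + u.
    by apply: cvgD; [apply: cvgZr_tmp; exact: cvg_id|exact: cvg_cst].
  by rewrite scale0r add0r.
have /nbhs_ballP[e /= e0 he] := cp _ gw.
exists e, (fun q => 2 * w q); split => //.
  apply: integrableZl_fin; first exact: measurable_itv.
  apply: (@integrableS _ _ _ mu `[a, +oo[ _ _ _ _ _ iw) => //.
  by apply: subset_itvr; rewrite bnd_simp ltW.
move=> h q he' sq; rewrite (le_trans (cnorm1_normc _))// ler_pM2l//.
by apply: he => //=; [rewrite /ball/= sub0r normrN|exact: le_trans (ltW as0) sq].
Qed.

Lemma K_dominated k i s u : exists (e : R) (w : R -> R),
  [/\ 0 < e, mu.-integrable `[s, +oo[ (EFin \o w) &
  forall l (h q : R), `|h| < e -> s <= q ->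
   [/\ cnorm1 (K i l s q (h *: delta_mx 0 k + u)) <= w q,
       cnorm1 (Ku k i l s q (h *: delta_mx 0 k + u)) <= w q &
       cnorm1 (Kq i l s q (h *: delta_mx 0 k + u)) <= w q]].
Proof.
have dom l : exists p : R * (R -> R), [/\ 0 < p.1, mu.-integrable `[s, +oo[ (EFin \o
  p.2) &
    forall h q : R, `|h| < p.1 -> s <= q ->
    [/\ cnorm1 (K i l s q (h *: delta_mx 0 k + u)) <= p.2 q,
       cnorm1 (Ku k i l s q (h *: delta_mx 0 k + u)) <= p.2 q &
       cnorm1 (Kq i l s q (h *: delta_mx 0 k + u)) <= p.2 q]].
  have [_ d0 d1] := K_reg i l.
  have [e0 [w0 [e0p iw0 h0]]] := locally_dominated_path s u (delta_mx 0 k) d0.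
  have [e1 [w1 [e1p iw1 h1]]] := locally_dominated_path s u (delta_mx 0 k) (d1 (0, 0,
    delta_mx 0 k)).
  have [e2 [w2 [e2p iw2 h2]]] := locally_dominated_path s u (delta_mx 0 k) (d1 (0, 1,
    0)).
  exists (Num.min e0 (Num.min e1 e2), fun q => w0 q + (w1 q + w2 q)); split => /=.
  - by rewrite !lt_min e0p e1p e2p.
  - by do 2 (apply: integrableD_fin => //).
  - move=> h q; rewrite !lt_min => /and3P[he0 he1 he2] sq.
    have a0 := h0 h q he0 sq; have a1 := h1 h q he1 sq; have a2 := h2 h q he2 sq.
    have p0 := le_trans (cnorm1_ge0 _) a0.
    have p1 := le_trans (cnorm1_ge0 _) a1.
    have p2 := le_trans (cnorm1_ge0 _) a2.
    split; [apply: (le_trans a0)|apply: (le_trans a1)|apply: (le_trans a2)].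
    + by rewrite lerDl addr_ge0.
    + by rewrite addrCA lerDl addr_ge0.
    + by rewrite addrA lerDr addr_ge0.
have [p hp] := choice dom.
(* One radius and one bound serve all columns. The default [1] keeps the radius positive when there
   are no indices; the sum dominates each term because every bound is nonnegative on the
   half-line. *)
exists (\big[Num.min/1]_l (p l).1), (fun q => \sum_l (p l).2 q); split.
- by elim/big_ind : _ => // [a b a0 b0|l _]; [rewrite lt_min a0|have [] := hp l].
- by apply: integrable_sum_fin => [|l]; [exact: measurable_itv|have [] := hp l].
- move=> l h q he sq.
  have le1 : (p l).2 q <= \sum_l (p l).2 q.
    rewrite (bigD1 l)//= lerDl sumr_ge0// => m _.
    have [e0 _ /(_ 0 q)] := hp m; rewrite normr0 => /(_ e0 sq)[h1 _ _].
    exact: le_trans (cnorm1_ge0 _) h1.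
  have hl : `|h| < (p l).1 by rewrite (lt_le_trans he)// (bigD1 l)//= ge_min lexx.
  have [_ _ /(_ h q hl sq)[h1 h2 h3]] := hp l.
  by split; exact: le_trans le1.
Qed.

End DressingCalculus.

(** * Derivatives of the integral equation in the second argument and in the coordinates *)

Section DressingEquations.
Local Open Scope complex_scope.
Context {R : realType} {N : nat}.
Notation mu := (@lebesgue_measure R).
Context (F : 'I_N -> 'I_N -> R -> R -> R[i]).
Context (K : 'I_N -> 'I_N -> R -> R -> 'rV[R]_N -> R[i]).
Hypothesis F_reg : regular_dressing F.
Hypothesis K_sol : is_the_solution F K.
Hypothesis K_reg : regular_kernel K.
Implicit Types (i j k l : 'I_N) (s t q x y : R) (u v : 'rV[R]_N).

Let mD s : measurable ((`[s, +oo[%classic : set R) : set (measurableTypeR R)).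
Proof. exact: measurable_itv. Qed.

Lemma K_eq i j s y u : K i j s y u = F i j (s - u 0 i) (y - u 0 j) +
  cintegral `[s, +oo[ (fun q => \sum_l K i l s q u * F l j (q - u 0 l) (y - u 0 j)).
Proof. by have [[_ e] _] := K_sol i s u; exact: e. Qed.

Lemma K_integrable i j s u : cintegrable `[s, +oo[ (fun q => K i j s q u).
Proof. by have [[h _] _] := K_sol i s u. Qed.

Lemma K_integrable_cnorm1 i j s u :
  mu.-integrable `[s, +oo[ (EFin \o (fun q => cnorm1 (K i j s q u))).
Proof. by apply: integrable_cnorm1; [exact: mD|exact: K_integrable]. Qed.

(** Dressing functions are bounded only on quadrants, so all shifted arguments need a common lower
    bound. *)
Lemma coord_lower_bound u (b : R) : exists a : R, forall l x, b <= x -> a <= x - u 0 l.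
Proof.
exists (b - \sum_l `|u 0 l|) => l x bx; rewrite lerB//.
by rewrite (bigD1 l)//= (le_trans (ler_norm _))// lerDl sumr_ge0.
Qed.

Lemma cintegrable_mulG (X : R -> R[i]) (G : R -> R -> R[i]) (M a y s : R) :
  ccontinuous X -> cintegrable `[s, +oo[ X ->
  ccontinuous (fun p : R * R => G p.1 p.2) ->
  (forall q, s <= q -> cnorm1 (G (q + a) y) <= M) ->
  cintegrable `[s, +oo[ (fun q => X q * G (q + a) y).
Proof.
move=> cX iX cG GM; apply: (cintegrable_mulb (mD s) (M := M)) => //.
- exact: (ccontinuous_shift (G := G) a y cG).
- by move=> q; rewrite /= in_itv/= andbT; exact: GM.
Qed.

Lemma cintegrable_KG (G : 'I_N -> 'I_N -> R -> R -> R[i]) (M : R) i j s (y : R) u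
    (a : 'I_N -> R) :
  (forall l, ccontinuous (fun p : R * R => G l j p.1 p.2)) ->
  (forall l q, s <= q -> cnorm1 (G l j (q + a l) y) <= M) ->
  cintegrable `[s, +oo[ (fun q => \sum_l K i l s q u * G l j (q + a l) y).
Proof.
move=> cG GM; apply: cintegrable_sum => [|l]; first exact: mD.
apply: (@cintegrable_mulG _ (G l j) M) => //; last exact: GM.
- exact: ccontinuous_K.
- exact: K_integrable.
Qed.

(** Under the integral [y] enters through [F] alone, so a bound on [F2] times the integrable row of
    [K] dominates the derivative. *)
Lemma Kq_eq i j s y u : Kq K i j s y u = F2 F i j (s - u 0 i) (y - u 0 j) +
  cintegral `[s, +oo[ (fun q => \sum_l K i l s q u * F2 F l j (q - u 0 l) (y - u 0 j)).
Proof.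
have dF l x (t : R) : is_cderive (fun t => F l j x (t - u 0 j)) t (F2 F l j x (t - u
  0 j)).
  have := @is_cderive_affine _ (F l j x) 1 (- u 0 j) t (F2 F l j x (t - u 0 j)).
  rewrite !mul1r => /(_ (is_cderive_F2 F_reg _ _ _ _)).
  by under eq_fun do rewrite mul1r.
(* The shift by [1] leaves room for [t] to vary within distance [1] of [y]. *)
have [a ha] := coord_lower_bound u (Num.min s (y - 1)).
have [M [M1 hM]] := F_bounded F_reg a.
have as_ l q : s <= q -> a <= q - u 0 l by move=> sq; apply: ha; rewrite ge_min sq.
have ay (t : R) : `|t - y| < 1 -> a <= t - u 0 j.
  by move=> ty; apply: ha; rewrite ge_min; apply/orP; right; move: ty;
    rewrite ltr_norml => /andP[? _]; lra.
rewrite -(is_cderiveE (is_cderive_Kq K_reg i j s y u)).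
under eq_fun do rewrite K_eq.
apply: is_cderiveE; apply: is_cderiveD; first exact: dF.
apply: (is_cderive_under_cintegral (mD s) (H' := fun t q =>
  \sum_l K i l s q u * F2 F l j (q - u 0 l) (t - u 0 j))
  (w := fun q => \sum_l M * cnorm1 (K i l s q u)) (e := 1)) => //.
- move=> t ty; apply: (@cintegrable_KG F M i j s _ u (fun l => - u 0 l)).
    by move=> l; exact: ccontinuous_F.
  by move=> l q sq; have [] := hM l j _ _ (as_ l q sq) (ay t ty).
- move=> t q ty _; apply: is_cderive_sum => l.
  have := is_cderiveM (is_cderive_cst (K i l s q u) t) (dF l (q - u 0 l) t).
  by rewrite mul0r add0r.
- apply: integrable_sum_fin => [|l]; first exact: mD.
  by apply: integrableZl_fin; [exact: mD|exact: K_integrable_cnorm1].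
- move=> t q ty; rewrite /= in_itv/= andbT => sq.
  rewrite (le_trans (cnorm1_sum _ _ _))// ler_sum// => l _.
  rewrite (le_trans (cnorm1M _ _))// mulrC ler_wpM2r ?cnorm1_ge0//.
  by have [] := hM l j _ _ (as_ l q sq) (ay t ty).
Qed.

Lemma coord_path k l u (h : R) : (h *: delta_mx 0 k + u) 0 l = h * (l == k)%:R + u 0 l.
Proof. by rewrite !mxE eqxx. Qed.

(* For [j = k] the second argument moves together with [u 0 k], so that the
   argument [y - u 0 j] of the dressing functions is unchanged. *)
Definition Kdir k i j s y u : R[i] := Ku K k i j s y u + (j == k)%:R * Kq K i j s y u.

(** Along the path of [Kdir] the second argument of each dressing function is fixed, and [i != k]
    fixes [s - u 0 i] too. The free term is therefore constant, and only the first argument of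
    [F k j] under the integral moves, whence the [F1] term. *)
Lemma Kdir_eq_deriv k i j s y u : i != k -> Kdir k i j s y u =
  cintegral `[s, +oo[ (fun q => \sum_l Ku K k i l s q u * F l j (q - u 0 l) (y - u 0 j)
     - K i k s q u * F1 F k j (q - u 0 k) (y - u 0 j)).
Proof.
move=> ik; pose uh (h : R) := h *: delta_mx 0 k + u : 'rV[R]_N.
(* The speed of [q - u 0 l] along the path. *)
pose d l : R := - (l == k)%:R.
have [e0 [w [e0p iw hw]]] := K_dominated K_reg k i s u.
pose e := Num.min e0 1.
have ep : 0 < e by rewrite lt_min e0p ltr01.
(* Since [e] is at most [1], moving one coordinate by [h] lowers a first argument by less than
   [1]. *)
have [a ha] := coord_lower_bound u (Num.min (s - 1) y).
have [M [M1 hM]] := F_bounded F_reg a.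
have au l q (h : R) : `|h| < e -> s <= q -> a <= q - uh h 0 l.
  rewrite lt_min => /andP[_ h1] sq; rewrite /uh coord_path opprD addrA; apply: ha.
  rewrite ge_min; apply/orP; left; case: (l == k); rewrite ?mulr0 ?mulr1 ?subr0.
    by move: h1; rewrite ltr_norml => /andP[_ ?]; lra.
  by lra.
have ay : a <= y - u 0 j by apply: ha; rewrite ge_min lexx orbT.
have uE q l (h : R) : q - uh h 0 l = d l * h + (q - u 0 l).
  by rewrite /uh coord_path /d; ring.
have dF l q (h : R) : is_cderive (fun h => F l j (q - uh h 0 l) (y - u 0 j)) h
    ((d l)%:C * F1 F l j (q - uh h 0 l) (y - u 0 j)).
  have := @is_cderive_affine _ (fun x => F l j x (y - u 0 j)) (d l) (q - u 0 l) h
    (F1 F l j (q - uh h 0 l) (y - u 0 j)).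
  rewrite -uE => /(_ (is_cderive_F1 F_reg _ _ _ _)).
  by under eq_fun do rewrite -uE.
have path0 (h : R) : K i j s (h * (j == k)%:R + y) (uh h) = F i j (s - u 0 i) (y - u
  0 j) +
    cintegral `[s, +oo[ (fun q => \sum_l K i l s q (uh h) * F l j (q - uh h 0 l) (y -
      u 0 j)).
  rewrite K_eq /uh coord_path (negbTE ik) mulr0 add0r coord_path.
  by have -> : h * (j == k)%:R + y - (h * (j == k)%:R + u 0 j) = y - u 0 j by ring.
have uh0 : uh 0 = u by rewrite /uh scale0r add0r.
have := is_cderive_Kpath K_reg i j s y u (delta_mx 0 k) (j == k)%:R 0.
rewrite mul0r add0r -/(uh 0) uh0 (cderive_Kfun K_reg) -/(Kdir k i j s y u).
under eq_fun do rewrite -/(uh _) path0.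
move=> /is_cderiveE <-.
have -> : cintegral `[s, +oo[ (fun q => \sum_l Ku K k i l s q u * F l j (q - u 0 l)
  (y - u 0 j)
     - K i k s q u * F1 F k j (q - u 0 k) (y - u 0 j)) =
   cintegral `[s, +oo[ (fun q => \sum_l (Ku K k i l s q (uh 0) * F l j (q - uh 0 0 l)
     (y - u 0 j) +
     K i l s q (uh 0) * ((d l)%:C * F1 F l j (q - uh 0 0 l) (y - u 0 j)))).
  apply: eq_cintegral => q _; rewrite uh0 big_split/=; congr (_ + _).
  rewrite (bigD1 k)//= big1 ?addr0 => [|l lk].
    by rewrite /d eqxx rmorphN mulN1r mulrN.
  by rewrite /d (negbTE lk) oppr0 mul0r mulr0.
apply: is_cderiveE; rewrite -[X in is_cderive _ _ X]add0r.
apply: is_cderiveD; first exact: is_cderive_cst.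
(* Each summand has two products, one with [Ku] and one with [K]; both are at most [M * w q], since
   [d l] is [0] or [-1]. This accounts for the factor [2 * M]. *)
apply: (is_cderive_under_cintegral (mD s) (H' := fun h q => \sum_l
   (Ku K k i l s q (uh h) * F l j (q - uh h 0 l) (y - u 0 j) +
     K i l s q (uh h) * ((d l)%:C * F1 F l j (q - uh h 0 l) (y - u 0 j))))
  (w := fun q => \sum_(l < N) (2 * M) * w q) (e := e)) => //.
- move=> h; rewrite subr0 => he; apply: (@cintegrable_KG F M i j s _ (uh h) (fun l =>
  - uh h 0 l)).
    by move=> l; exact: ccontinuous_F.
  by move=> l q sq; have [] := hM l j _ _ (au l q h he sq) ay.
- move=> h q; rewrite subr0 => he _; apply: is_cderive_sum => l.
  by apply: is_cderiveM; [exact: is_cderive_Ku|exact: dF].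
- by apply: integrable_sum_fin => [|l]; [exact: mD|apply: integrableZl_fin => //;
  exact: mD].
- move=> h q; rewrite subr0 /= in_itv/= andbT => he sq.
  rewrite (le_trans (cnorm1_sum _ _ _))// ler_sum// => l _.
  have he0 : `|h| < e0 by move: he; rewrite lt_min => /andP[].
  have [b1 b2 _] := hw l h q he0 sq.
  have [c1 c2 _] := hM l j _ _ (au l q h he sq) ay.
  rewrite (le_trans (cnorm1D _ _))//.
  have -> : 2 * M * w q = w q * M + w q * M by ring.
  rewrite lerD// (le_trans (cnorm1M _ _))// ler_pM ?cnorm1_ge0//.
  apply: le_trans c2; rewrite (le_trans (cnorm1M _ _))//.
  rewrite ler_piMl ?cnorm1_ge0// /d; case: (l == k);
    rewrite /cnorm1/= ?oppr0 ?normrN ?normr0 ?normr1 ?addr0//.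
Qed.

Lemma Ku_Kq_integrable k i l s u :
  cintegrable `[s, +oo[ (fun q => Ku K k i l s q u) /\
  cintegrable `[s, +oo[ (fun q => Kq K i l s q u).
Proof.
have [e [w [e0 iw hw]]] := K_dominated K_reg k i s u.
have {}hw q : s <= q -> cnorm1 (Ku K k i l s q u) <= w q /\ cnorm1 (Kq K i l s q u)
  <= w q.
  by move=> sq; have := hw l 0 q; rewrite normr0 scale0r add0r => /(_ e0 sq)[].
split; apply: (cintegrable_le (mD s) _ iw).
- exact: ccontinuous_Ku.
- by move=> q; rewrite /= in_itv/= andbT => /hw[].
- exact: ccontinuous_Kq.
- by move=> q; rewrite /= in_itv/= andbT => /hw[].
Qed.

Lemma ccontinuous_Kdir k i j s u : ccontinuous (fun q => Kdir k i j s q u).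
Proof.
apply: ccontinuousD; first exact: ccontinuous_Ku.
by apply: ccontinuousM; [exact: ccontinuous_cst|exact: ccontinuous_Kq].
Qed.

Lemma Kdir_integrable k i j s u : cintegrable `[s, +oo[ (fun q => Kdir k i j s q u).
Proof.
have [h1 h2] := Ku_Kq_integrable k i j s u.
apply: (cintegrableD (mD s)) => //; exact: (cintegrableZl (mD s)).
Qed.

(** Integration by parts moves the derivative off [F k j]: the boundary value at [s] becomes the
    free term, and the resulting [Kq] in column [k] is exactly what completes [Ku] to [Kdir]
    there. *)
Lemma Kdir_eq k i j s y u : i != k -> Kdir k i j s y u =
  K i k s s u * F k j (s - u 0 k) (y - u 0 j) +
  cintegral `[s, +oo[ (fun q => \sum_l Kdir k i l s q u * F l j (q - u 0 l) (y - u 0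
    j)).
Proof.
move=> ik; rewrite Kdir_eq_deriv//.
have [a ha] := coord_lower_bound u (Num.min s y).
have [M [M1 hM]] := F_bounded F_reg a.
have au l q : s <= q -> a <= q - u 0 l by move=> sq; apply: ha; rewrite ge_min sq.
have ay : a <= y - u 0 j by apply: ha; rewrite ge_min lexx orbT.
have bF l q : s <= q -> cnorm1 (F l j (q - u 0 l) (y - u 0 j)) <= M.
  by move=> sq; have [] := hM l j _ _ (au l q sq) ay.
have bF1 l q : s <= q -> cnorm1 (F1 F l j (q - u 0 l) (y - u 0 j)) <= M.
  by move=> sq; have [] := hM l j _ _ (au l q sq) ay.
have iKuF : cintegrable `[s, +oo[ (fun q => \sum_l Ku K k i l s q u * F l j (q - u 0
  l) (y - u 0 j)).
  apply: (cintegrable_sum (mD s)) => l; have [h _] := Ku_Kq_integrable k i l s u.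
  by apply: (@cintegrable_mulG _ (F l j) M) => //;
    [exact: ccontinuous_Ku|exact: ccontinuous_F|exact: bF].
have iKqF : cintegrable `[s, +oo[ (fun q => Kq K i k s q u * F k j (q - u 0 k) (y - u
  0 j)).
  have [_ h] := Ku_Kq_integrable k i k s u.
  by apply: (@cintegrable_mulG _ (F k j) M) => //;
    [exact: ccontinuous_Kq|exact: ccontinuous_F|exact: bF].
have iKF : cintegrable `[s, +oo[ (fun q => K i k s q u * F k j (q - u 0 k) (y - u 0 j)).
  by apply: (@cintegrable_mulG _ (F k j) M) => //;
    [exact: ccontinuous_K|exact: K_integrable|exact: ccontinuous_F|exact: bF].
have iKF1 : cintegrable `[s, +oo[ (fun q => K i k s q u * F1 F k j (q - u 0 k) (y - u
  0 j)).
  by apply: (@cintegrable_mulG _ (F1 F k j) M) => //;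
    [exact: ccontinuous_K|exact: K_integrable|exact: ccontinuous_F1|exact: bF1].
have dF q : is_cderive (fun q => F k j (q - u 0 k) (y - u 0 j)) q (F1 F k j (q - u 0
  k) (y - u 0 j)).
  have := @is_cderive_affine _ (fun x => F k j x (y - u 0 j)) 1 (- u 0 k) q
    (F1 F k j (q - u 0 k) (y - u 0 j)).
  rewrite !mul1r => /(_ (is_cderive_F1 F_reg _ _ _ _)).
  by under eq_fun do rewrite mul1r.
have parts : cintegral `[s, +oo[ (fun q => Kq K i k s q u * F k j (q - u 0 k) (y - u
  0 j) +
    K i k s q u * F1 F k j (q - u 0 k) (y - u 0 j)) =
    - (K i k s s u * F k j (s - u 0 k) (y - u 0 j)).
  apply: (@cintegral_derive_itvcy _ (fun q => K i k s q u * F k j (q - u 0 k) (y - u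
    0 j))) => //.
  - by move=> q; apply: is_cderiveM; [exact: is_cderive_Kq|exact: dF].
  - apply: ccontinuousD; apply: ccontinuousM.
    + exact: ccontinuous_Kq.
    + by apply: (@ccontinuous_shift _ (F k j)); exact: ccontinuous_F.
    + exact: ccontinuous_K.
    + by apply: (@ccontinuous_shift _ (F1 F k j)); exact: ccontinuous_F1.
  - exact: (cintegrableD (mD s)).
have -> : cintegral `[s, +oo[ (fun q => \sum_l Kdir k i l s q u * F l j (q - u 0 l)
  (y - u 0 j)) =
    cintegral `[s, +oo[ (fun q => \sum_l Ku K k i l s q u * F l j (q - u 0 l) (y - u
      0 j)
      + Kq K i k s q u * F k j (q - u 0 k) (y - u 0 j)).
  apply: eq_cintegral => q _; under eq_bigr do rewrite mulrDl.
  rewrite big_split/=; congr (_ + _).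
  rewrite (bigD1 k)//= big1 ?addr0 => [|l lk]; first by rewrite eqxx mul1r.
  by rewrite (negbTE lk) !mul0r.
move: parts; rewrite (cintegralD (mD s))// => /eqP; rewrite eq_sym eqr_oppLR => /eqP ->.
have iN := cintegrableZl (mD s) (-1) iKF1.
rewrite (cintegralD (mD s) iKuF iKqF) -[X in X = _](eq_cintegral (g := fun q =>
  \sum_l Ku K k i l s q u * F l j (q - u 0 l) (y - u 0 j) +
  (-1) * (K i k s q u * F1 F k j (q - u 0 k) (y - u 0 j)))); last first.
  by move=> q _; rewrite mulN1r.
rewrite (cintegralD (mD s) iKuF iN) (cintegralZl (mD s) _ iKF1); ring.
Qed.

(* [Kdir k i] solves the [k]-th row equation up to the factor [K i k s s u];
   uniqueness of the solution identifies it. *)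
Lemma Kdir_darboux k i j s y u : i != k ->
  Kdir k i j s y u = K i k s s u * K k j s y u.
Proof.
move=> ik; pose c := K i k s s u.
(* Uniqueness is available for the inhomogeneous row equation, so the difference, which solves the
   homogeneous one, is added to the solution [K k]; it must then vanish. *)
pose kap j y := K k j s y u + (Kdir k i j s y u + (- c) * K k j s y u).
have ikap j' : cintegrable `[s, +oo[ (kap j').
  apply: (cintegrableD (mD s)); first exact: K_integrable.
  apply: (cintegrableD (mD s)); first exact: Kdir_integrable.
  by apply: (cintegrableZl (mD s)); exact: K_integrable.
have [_ /(_ kap)] := K_sol k s u.
suff rk : row_solution F k s u kap.
  move=> /(_ rk j y) /eqP; rewrite /kap -[X in _ == X]addr0 (inj_eq (addrI _)) mulNr
    subr_eq0.
  by move/eqP.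
split=> // j' y'; rewrite /kap /dressing K_eq Kdir_eq// -/c.
have [a ha] := coord_lower_bound u (Num.min s y').
have [M [M1 hM]] := F_bounded F_reg a.
have au l q : s <= q -> a <= q - u 0 l by move=> sq; apply: ha; rewrite ge_min sq.
have ay : a <= y' - u 0 j' by apply: ha; rewrite ge_min lexx orbT.
have bF l q : s <= q -> cnorm1 (F l j' (q - u 0 l) (y' - u 0 j')) <= M.
  by move=> sq; have [] := hM l j' _ _ (au l q sq) ay.
have iKF : cintegrable `[s, +oo[ (fun q => \sum_l K k l s q u * F l j' (q - u 0 l)
  (y' - u 0 j')).
  by apply: (@cintegrable_KG F M) => l; [exact: ccontinuous_F|exact: bF].
have iLF : cintegrable `[s, +oo[ (fun q => \sum_l Kdir k i l s q u * F l j' (q - u 0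
  l) (y' - u 0 j')).
  apply: (cintegrable_sum (mD s)) => l.
  by apply: (@cintegrable_mulG _ (F l j') M) => //;
    [exact: ccontinuous_Kdir|exact: Kdir_integrable|exact: ccontinuous_F|exact: bF].
have -> : cintegral `[s, +oo[ (fun q => \sum_l kap l q * F l j' (q - u 0 l) (y' - u 0
  j')) =
   cintegral `[s, +oo[ (fun q => \sum_l K k l s q u * F l j' (q - u 0 l) (y' - u 0 j') +
     (\sum_l Kdir k i l s q u * F l j' (q - u 0 l) (y' - u 0 j') +
      (- c) * \sum_l K k l s q u * F l j' (q - u 0 l) (y' - u 0 j'))).
  apply: eq_cintegral => q _; rewrite mulr_sumr -!big_split/=; apply: eq_bigr => l _.
  by rewrite /kap; ring.
have iZ := cintegrableZl (mD s) (- c) iKF.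
rewrite (cintegralD (mD s) iKF (cintegrableD (mD s) iLF iZ)) (cintegralD (mD s) iLF
  iZ) (cintegralZl (mD s) _ iKF).
ring.
Qed.

End DressingEquations.

(** * The quadratic identity for a general weight *)

Section WeightedIdentity.
Local Open Scope complex_scope.
Context {R : realType} {N : nat}.
Notation mu := (@lebesgue_measure R).
Notation Re := complex.Re.
Notation Im := complex.Im.
Context (F : 'I_N -> 'I_N -> R -> R -> R[i]).
Context (K : 'I_N -> 'I_N -> R -> R -> 'rV[R]_N -> R[i]).
Hypothesis F_reg : regular_dressing F.
Hypothesis K_sol : is_the_solution F K.
Hypothesis K_reg : regular_kernel K.
Implicit Types (i j k l m : 'I_N) (s t q x y : R) (u v : 'rV[R]_N) (z w : R[i]).

Let mD s : measurable ((`[s, +oo[%classic : set R) : set (measurableTypeR R)).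
Proof. exact: measurable_itv. Qed.

(** Bridges [weight_compatible], which concerns products of the weight and [K], and
    [admissible_row], which asks for products of norms. *)
Lemma cintegrable_cnorm1M s (g h : R -> R[i]) : ccontinuous g -> ccontinuous h ->
  cintegrable `[s, +oo[ (fun q => g q * h q) ->
  mu.-integrable `[s, +oo[ (EFin \o (fun q => cnorm1 (g q) * cnorm1 (h q))).
Proof.
move=> cg ch igh.
have iw := integrableZl_fin (mD s) 4 (integrable_cnorm1 (mD s) igh).
apply: (@le_integrable _ _ _ mu _ (mD s) _ _ _ _ iw).
  apply/measurable_EFinP; apply: measurable_funTS;
    apply: continuous_measurable_fun => q.
  by apply: cvgM; exact: continuous_cnorm1.
move=> q _; rewrite lee_fin !ger0_norm ?mulr_ge0 ?cnorm1_ge0//.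
exact: cnorm1M_ge.
Qed.

Context (f : 'I_N -> R -> R[i]).
Hypothesis f_C1 : forall m, C1 (f m).
Hypothesis K_weight : weight_compatible f K.

Let f' m x := cderive (f m) x (1 : R).

(** Where the square roots do not vanish this is [r l (u 0 l - p.1) * r m (u 0 m - p.2)] times the
    derivative of [dressing_tilde] in its second argument; the minus sign comes from the reflected
    argument [u 0 m - p.2]. *)
Definition weighted_dressing u l m (p : R * R) : R[i] :=
  f m (u 0 m - p.2) * F2 F l m (p.1 - u 0 l) (p.2 - u 0 m) -
  2^-1 * f' m (u 0 m - p.2) * F l m (p.1 - u 0 l) (p.2 - u 0 m).

Lemma is_cderive_f m x : is_cderive (f m) x (f' m x).
Proof.
have := is_cderive_slice (0 : R) (1 : R) x (f_C1 m).
rewrite /f' addr0 [_ *: 1]mulr1.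
by under eq_fun do rewrite addr0 [_ *: 1]mulr1.
Qed.

Let cf m : ccontinuous (f m). Proof. exact: C1_continuous. Qed.
Let cf' m : ccontinuous (f' m). Proof. exact: (f_C1 m).2. Qed.

Lemma ccontinuous_weighted_dressing u l m : ccontinuous (weighted_dressing u l m).
Proof.
have c2 (g : R -> R[i]) : ccontinuous g -> ccontinuous (fun p : R * R =>
  g (u 0 m - p.2)).
  move=> cg; apply: (@ccontinuous_comp _ _ _ snd (fun y => g (u 0 m - y))).
    exact: ccontinuous_reflect.
  by move=> p; exact: cvg_snd.
have cG (G : R -> R -> R[i]) : ccontinuous (fun p : R * R => G p.1 p.2) ->
    ccontinuous (fun p : R * R => G (p.1 - u 0 l) (p.2 - u 0 m)).
  move=> cG; apply: (@ccontinuous_comp _ _ _ (fun p : R * R =>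
    (p.1 - u 0 l, p.2 - u 0 m)) _ cG) => p.
  apply: (@cvg_pair _ _ _ (nbhs p) (nbhs (p.1 - u 0 l)) (nbhs (p.2 - u 0 m))).
    by apply: cvgB; [exact: cvg_fst|exact: cvg_cst].
  by apply: cvgB; [exact: cvg_snd|exact: cvg_cst].
apply: ccontinuousD; first by apply: ccontinuousM; [exact: c2|apply: cG;
  exact: ccontinuous_F2].
apply: ccontinuousN; apply: ccontinuousM; last by apply: cG; exact: ccontinuous_F.
by apply: ccontinuousM; [exact: ccontinuous_cst|exact: c2].
Qed.

(** The operation that takes [F] to [weighted_dressing], applied to row [i] of [K]. *)
Definition weighted_row u i s m q : R[i] :=
  f m (u 0 m - q) * Kq K i m s q u - 2^-1 * f' m (u 0 m - q) * K i m s q u.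

(** Integrability gives no pointwise bound; the integral equation does, as its right side pairs
    bounded dressing functions with an integrable row that does not depend on the second
    argument. *)
Lemma K_bounded i s u : exists M : R, forall m q, s <= q -> cnorm1 (K i m s q u) <= M.
Proof.
have [a ha] := coord_lower_bound u s.
have [M [M1 hM]] := F_bounded F_reg a.
have iw : mu.-integrable `[s, +oo[ (EFin \o (fun q => \sum_l M * cnorm1 (K i l s q u))).
  by apply: (integrable_sum_fin (mD s)) => l; apply: (integrableZl_fin (mD s));
    exact: (K_integrable_cnorm1 K_sol).
exists (M + \int[mu]_(q in `[s, +oo[) \sum_l M * cnorm1 (K i l s q u)) => m y sy.
rewrite (K_eq K_sol) (le_trans (cnorm1D _ _))// lerD//.
  by have [] := hM i m _ _ (ha i s (lexx s)) (ha m y sy).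
apply: (cnorm1_cintegral (mD s) _ iw).
  apply: (@cintegrable_KG _ _ F K K_sol K_reg F M i m s _ u (fun l => - u 0 l)) => l.
    exact: ccontinuous_F.
  by move=> q sq; have [] := hM l m _ _ (ha l q sq) (ha m y sy).
move=> q; rewrite /= in_itv/= andbT => sq.
rewrite (le_trans (cnorm1_sum _ _ _))// ler_sum// => l _.
rewrite (le_trans (cnorm1M _ _))// mulrC ler_wpM2r ?cnorm1_ge0//.
by have [] := hM l m _ _ (ha l q sq) (ha m y sy).
Qed.

(** For fixed [y] the weights are constants under the integral, so the claim is the combination of
    [Kq_eq] and [K_eq] with coefficients [c2] and [c0]. *)
Lemma weighted_row_resolvent u i s : resolvent_form s (weighted_dressing u) i
  (fun l q => K i l s q u) (weighted_row u i s).
Proof.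
move=> m y; rewrite /weighted_row (Kq_eq F_reg K_sol K_reg) (K_eq K_sol).
have [a ha] := coord_lower_bound u (Num.min s y).
have [M [M1 hM]] := F_bounded F_reg a.
have as_ l q : s <= q -> a <= q - u 0 l by move=> sq; apply: ha; rewrite ge_min sq.
have ay : a <= y - u 0 m by apply: ha; rewrite ge_min lexx orbT.
have i2 : cintegrable `[s, +oo[ (fun q => \sum_l K i l s q u * F2 F l m (q - u 0 l)
  (y - u 0 m)).
  apply: (@cintegrable_KG _ _ F K K_sol K_reg (F2 F) M i m s _ u (fun l =>
    - u 0 l)) => l.
    exact: ccontinuous_F2.
  by move=> q sq; have [] := hM l m _ _ (as_ l q sq) ay.
have i0 : cintegrable `[s, +oo[ (fun q => \sum_l K i l s q u * F l m (q - u 0 l) (y -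
  u 0 m)).
  apply: (@cintegrable_KG _ _ F K K_sol K_reg F M i m s _ u (fun l => - u 0 l)) => l.
    exact: ccontinuous_F.
  by move=> q sq; have [] := hM l m _ _ (as_ l q sq) ay.
pose c2 := f m (u 0 m - y); pose c0 := - (2^-1 * f' m (u 0 m - y)).
rewrite (@eq_cintegral _ _ (fun q => \sum_l K i l s q u * weighted_dressing u l m (q,
  y))
  (fun q => c2 * (\sum_l K i l s q u * F2 F l m (q - u 0 l) (y - u 0 m)) +
            c0 * (\sum_l K i l s q u * F l m (q - u 0 l) (y - u 0 m)))); last first.
  move=> q _; rewrite !mulr_sumr -big_split/=; apply: eq_bigr => l _.
  by rewrite /weighted_dressing /c2 /c0/=; ring.
rewrite (cintegralD (mD s) (cintegrableZl (mD s) c2 i2) (cintegrableZl (mD s) c0 i0)).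
rewrite (cintegralZl (mD s) _ i2) (cintegralZl (mD s) _ i0) /weighted_dressing /c2
  /c0/=.
ring.
Qed.

Lemma weighted_identity i j s u :
  (forall l m x y, weighted_dressing u l m (x, y) = - weighted_dressing u m l (y, x)) ->
  weighted_row u i s j s + weighted_row u j s i s =
  \sum_m f m (u 0 m - s) * K i m s s u * K j m s s u.
Proof.
move=> anti.
have [a ha] := coord_lower_bound u s.
have [M [M1 hM]] := F_bounded F_reg a.
(* [M] bounds [F] and [F2], and the coefficient [2^-1] is estimated by [1]. The weights depend on
   the column variable only, hence so does the bound. *)
pose W m y : R := M * (cnorm1 (f m (u 0 m - y)) + cnorm1 (f' m (u 0 m - y))).
have [B hB] := K_bounded i s u.
have CW l m x y : `[s, +oo[%classic x -> `[s, +oo[%classic y ->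
    cnorm1 (weighted_dressing u l m (x, y)) <= W m y.
  rewrite /= !in_itv/= !andbT => sx sy.
  have [b0 _ b2] := hM l m _ _ (ha l x sx) (ha m y sy).
  rewrite (le_trans (cnorm1D _ _))// /W mulrDr cnorm1N lerD//.
    by rewrite (le_trans (cnorm1M _ _))// mulrC ler_wpM2r ?cnorm1_ge0.
  rewrite -mulrA (le_trans (cnorm1M _ _))//.
  rewrite (le_trans (ler_piMl (cnorm1_ge0 _) cnorm1_half))//.
  by rewrite (le_trans (cnorm1M _ _))// mulrC ler_wpM2r ?cnorm1_ge0.
have adm i' : admissible_row s W (fun m q => K i' m s q u).
  move=> m; split; [exact: ccontinuous_K|exact: (K_integrable K_sol)|].
  have [w1 w2] := K_weight i' m s u.
  have c1 : ccontinuous (fun q => f m (u 0 m - q)) by exact: ccontinuous_reflect.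
  have c2 : ccontinuous (fun q => f' m (u 0 m - q)) by exact: ccontinuous_reflect.
  have cK := ccontinuous_K K_reg i' m s u.
  have iS := integrableZl_fin (mD s) M (integrableD_fin (mD s) (cintegrable_cnorm1M
    c1 cK w1) (cintegrable_cnorm1M c2 cK w2)).
  apply: (@eq_integrable _ _ _ mu _ (mD s) _ _ _ iS) => q _ /=.
  by rewrite /W -mulrDl mulrA.
have cE i' m : ccontinuous (weighted_row u i' s m).
  apply: ccontinuousD.
    by apply: ccontinuousM; [exact: ccontinuous_reflect|exact: ccontinuous_Kq].
  apply: ccontinuousN; apply: ccontinuousM; last exact: ccontinuous_K.
  by apply: ccontinuousM; [exact: ccontinuous_cst|exact: (@ccontinuous_reflect _ (f'
    m))].
apply: (@antisymmetric_weighted_identity _ _ s (weighted_dressing u) W _ anti CW i j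
  (fun m q => K i m s q u) (fun m q => K j m s q u)
  (fun m q => Kq K i m s q u) (fun m q => Kq K j m s q u) _ _
  (fun m q => f m (u 0 m - q)) (fun m q => - f' m (u 0 m - q)) B) => //.
- exact: ccontinuous_weighted_dressing.
- exact: weighted_row_resolvent.
- exact: weighted_row_resolvent.
- by move=> m q; exact: is_cderive_Kq.
- by move=> m q; exact: is_cderive_Kq.
- move=> m q; have := @is_cderive_affine _ (f m) (-1) (u 0 m) q (f' m (u 0 m - q)).
  rewrite mulN1r addrC => /(_ (is_cderive_f _ _)).
  rewrite rmorphN mulN1r.
  by under eq_fun do rewrite mulN1r addrC.
- by move=> m q; rewrite /weighted_row; ring.
- by move=> m q; rewrite /weighted_row; ring.
- by move=> m; exact: ccontinuous_reflect.
- move=> m q _; rewrite /W (le_trans (_ : _ <= M * cnorm1 (f m (u 0 m - q))))//.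
    by rewrite ler_peMl ?cnorm1_ge0.
  by rewrite ler_wpM2l ?lerDl ?cnorm1_ge0//; exact: le_trans ler01 M1.
- by move=> m q; rewrite /= in_itv/= andbT; exact: hB.
Qed.

End WeightedIdentity.

(** * Rotation coefficients *)

Section RotationCoefficients.
Local Open Scope complex_scope.
Context {R : realType}.
Notation Re := complex.Re.
Notation Im := complex.Im.

Lemma continuous_dense_zero (g : R * R -> R) x y : continuous g ->
  (forall e, 0 < e ->
    exists x' y', [/\ `|x - x'| < e, `|y - y'| < e & g (x', y') = 0]) ->
  g (x, y) = 0.
Proof.
move=> cg dg; apply/eqP/negP => /negP gn0.
have /cvgrPdist_lt/(_ `|g (x, y)|) := cg (x, y).
rewrite normr_gt0 => /(_ gn0) /nbhs_ballP[e /= e0 he].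
have [x' [y' [xx' yy' g0]]] := dg e e0.
by have := he (x', y'); rewrite /ball/= g0 subr0 ltxx => /(_ (conj xx' yy')).
Qed.

Lemma ccontinuous_dense_zero (g : R * R -> R[i]) x y : ccontinuous g ->
  (forall e, 0 < e ->
    exists x' y', [/\ `|x - x'| < e, `|y - y'| < e & g (x', y') = 0]) ->
  g (x, y) = 0.
Proof.
move=> [gr gi] dg; apply: complex_eqP => /=.
  apply: (continuous_dense_zero gr) => e /dg[x' [y' [? ? g0]]].
  by exists x', y'; rewrite g0.
apply: (continuous_dense_zero gi) => e /dg[x' [y' [? ? g0]]].
by exists x', y'; rewrite g0.
Qed.

Context {N : nat}.
Context (F : 'I_N -> 'I_N -> R -> R -> R[i]).
Hypothesis F_reg : regular_dressing F.
Implicit Types (i j k l m : 'I_N) (s t q x y : R) (u v : 'rV[R]_N).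

Lemma is_cderive_dressing l m x y u :
  is_cderive (fun t => dressing F l m x t u) y (F2 F l m (x - u 0 l) (y - u 0 m)).
Proof.
rewrite /dressing.
have := @is_cderive_affine _ (F l m (x - u 0 l)) 1 (- u 0 m) y (F2 F l m (x - u 0 l)
  (y - u 0 m)).
rewrite !mul1r => /(_ (is_cderive_F2 F_reg _ _ _ _)).
by under eq_fun do rewrite /= mul1r.
Qed.

(** With constant weight [1] the term in the derivative of the weight drops out and
    [weighted_dressing] is the plain [F2]; both derivatives in the Zakharov relation are taken in
    the second argument of their dressing function. *)
Lemma zakharov_antisymmetric u :
  (forall l m x y, zakharov_at (dressing F) l m x y u) ->
  forall l m x y, weighted_dressing F (fun _ _ => 1) u l m (x, y) =
    - weighted_dressing F (fun _ _ => 1) u m l (y, x).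
Proof.
move=> zak l m x y; have := zak l m x y.
rewrite /zakharov_at !(is_cderiveE (is_cderive_dressing _ _ _ _ _)) => /eqP;
  rewrite addr_eq0 => /eqP E.
rewrite /weighted_dressing /= !(is_cderiveE (is_cderive_cst _ _)) E.
by rewrite !mulr0 !mul0r !subr0 !mul1r.
Qed.

Context (f r : 'I_N -> R -> R[i]).
Hypothesis f_C1 : forall i, C1 (f i).
Hypothesis r_sqrt : sqrt_branch f r.

Lemma sqrt_branch_derive m x : cderivable (r m) x (1 : R) ->
  r m x * cderive (r m) x 1 = 2^-1 * cderive (f m) x 1.
Proof.
move=> dr; have d := cderivableP dr.
have -> : f m = fun x => r m x * r m x.
  by apply/funext => t; have [<- _] := r_sqrt m t; rewrite expr2.
by rewrite (is_cderiveE (is_cderiveM d d)); field.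
Qed.

Lemma is_cderive_dressing_tilde l m x y u : cderivable (r m) (u 0 m - y) (1 : R) ->
  is_cderive (fun t => dressing_tilde r F l m x t u) y
  ((- cderive (r m) (u 0 m - y) 1 / r l (u 0 l - x)) * dressing F l m x y u +
   r m (u 0 m - y) / r l (u 0 l - x) * F2 F l m (x - u 0 l) (y - u 0 m)).
Proof.
move=> dr; apply: is_cderiveM; last exact: is_cderive_dressing.
have := @is_cderive_affine _ (r m) (-1) (u 0 m) y (cderive (r m) (u 0 m - y) 1).
rewrite mulN1r addrC => /(_ (cderivableP dr)).
rewrite rmorphN mulN1r; under eq_fun do rewrite mulN1r addrC.
move=> d; have := is_cderiveM d (is_cderive_cst (r l (u 0 l - x))^-1 y).
by rewrite mulr0 addr0.
Qed.

(** The relation is available only off the zeros of the weights, but the antisymmetry defect is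
    continuous and such points are dense. *)
Lemma zakharov_tilde_antisymmetric u :
  (forall i (a b : R), a < b -> exists2 x, a < x < b & f i x != 0) ->
  (forall l m x y, f l (u 0 l - x) != 0 -> f m (u 0 m - y) != 0 ->
     zakharov_at (dressing_tilde r F) l m x y u) ->
  forall l m x y,
    weighted_dressing F f u l m (x, y) = - weighted_dressing F f u m l (y, x).
Proof.
move=> f_neq0 zak l m x y; apply/eqP; rewrite -addr_eq0; apply/eqP.
pose h (p : R * R) := weighted_dressing F f u l m p + weighted_dressing F f u m l
  (p.2, p.1).
apply: (@ccontinuous_dense_zero h x y).
  apply: ccontinuousD; first exact: ccontinuous_weighted_dressing.
  apply: (@ccontinuous_comp _ _ _ (fun p : R * R =>
    (p.2, p.1)) (weighted_dressing F f u m l)).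
    exact: ccontinuous_weighted_dressing.
  move=> p; apply: (@cvg_pair _ _ _ (nbhs p) (nbhs p.2) (nbhs p.1));
    [exact: cvg_snd|exact: cvg_fst].
move=> e e0.
(* The two nonvanishing conditions concern separate variables, so [x'] and [y'] can be chosen
   independently. *)
have near k z : exists z', `|z - z'| < e /\ f k (u 0 k - z') != 0.
  have [|w /andP[w1 w2] fw] := f_neq0 k (u 0 k - z - e) (u 0 k - z + e); first by lra.
  exists (u 0 k - w); rewrite subKr ltr_norml; split=> //; lra.
have [x' [xx' fx]] := near l x; have [y' [yy' fy]] := near m y.
exists x', y'; split => //; rewrite /h /weighted_dressing/=.
have dl := (r_sqrt l (u 0 l - x')).2 fx; have dm := (r_sqrt m (u 0 m - y')).2 fy.
have := zak l m x' y' fx fy.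
rewrite /zakharov_at (is_cderiveE (is_cderive_dressing_tilde _ _ dm)) (is_cderiveE
  (is_cderive_dressing_tilde _ _ dl)).
rewrite -(sqrt_branch_derive dl) -(sqrt_branch_derive dm) /dressing.
move: fx fy; rewrite -(r_sqrt l (u 0 l - x')).1 -(r_sqrt m (u 0 m - y')).1.
rewrite !sqrf_eq0 => rl rm E.
(* The defect is the Zakharov relation multiplied by the two square roots, the same factor for both
   of its terms. *)
apply: etrans (mulr0 (r l (u 0 l - x') * r m (u 0 m - y'))); rewrite -E; field.
by rewrite rl rm.
Qed.

Context (K : 'I_N -> 'I_N -> R -> R -> 'rV[R]_N -> R[i]).
Hypothesis K_sol : is_the_solution F K.
Hypothesis K_reg : regular_kernel K.

(** [rotation] transposes, so the coordinate of differentiation is the column index of [K]: this is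
    [Kdir] in the case where its [Kq] term is present. *)
Lemma pderive_rotation i j s u : i != j ->
  pderive i (rotation K i j s) u = K j i s s u * K i i s s u - Kq K j i s s u.
Proof.
move=> ij; rewrite /pderive cderive_along_line /rotation.
rewrite (is_cderiveE (is_cderive_Ku K_reg i j i s s u 0)) scale0r add0r.
rewrite -(Kdir_darboux F_reg K_sol K_reg) 1?eq_sym// /Kdir eqxx mul1r.
by rewrite addrK.
Qed.

Lemma pderive_sqrt_rotation i j s u : i != j -> cderivable (r i) (u 0 i - s) (1 : R) ->
  pderive i (fun v => r i (v 0 i - s) * rotation K i j s v) u =
  cderive (r i) (u 0 i - s) 1 * K j i s s u +
  r i (u 0 i - s) * pderive i (rotation K i j s) u.
Proof.
move=> ij dr; rewrite /pderive cderive_along_line [in RHS](cderive_along_line _ u)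
  /rotation.
have dK := is_cderive_Ku K_reg i j i s s u 0.
rewrite (is_cderiveE dK); apply: is_cderiveE.
have := @is_cderive_affine _ (r i) 1 (u 0 i - s) 0 (cderive (r i) (u 0 i - s) 1).
rewrite mulr0 add0r mul1r => /(_ (cderivableP dr)) dr0.
have := is_cderiveM dr0 dK; rewrite mulr0 !scale0r !add0r.
suff E (h : R) : 1 * h + (u 0 i - s) = (h *: delta_mx 0 i + u) 0 i - s.
  by under eq_fun do rewrite E.
by rewrite coord_path eqxx mulr1 mul1r addrA.
Qed.

End RotationCoefficients.

(** The terms split off contain [K i i] and [K j j], which are not among the coefficients summed in
    the equations; they cancel against the products supplied by [pderive_rotation]. *)
Lemma sum_pair_rest (V : nmodType) (N : nat) (i j : 'I_N) (G : 'I_N -> V) : i != j ->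
  \sum_m G m = G i + G j + \sum_(p < N | (p != i) && (p != j)) G p.
Proof.
move=> ij; rewrite (bigD1 i)//= (bigD1 j)/=; last by rewrite eq_sym.
by rewrite addrA.
Qed.

(** The second identity is conditional on derivability because a branch of the square root may fail
    to be derivable at a zero of [f i]; elsewhere [sqrt_branch] provides it. *)
Theorem lemma5p1 (R : realType) (N : nat)
  (f r : 'I_N -> R -> R[i])
  (F : 'I_N -> 'I_N -> R -> R -> R[i])
  (K : 'I_N -> 'I_N -> R -> R -> 'rV[R]_N -> R[i])
  (f_C1 : forall i, C1 (f i))
  (f_neq0 : forall i (a b : R), a < b -> exists2 x, a < x < b & f i x != 0)
  (r_sqrt : sqrt_branch f r)
  (F_reg : regular_dressing F)
  (K_sol : is_the_solution F K)
  (K_reg : regular_kernel K)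
  (K_weight : weight_compatible f K)
  (F_zakharov : forall i j s s' (u : 'rV[R]_N), zakharov_at (dressing F) i j s s' u)
  (Ft_zakharov : forall i j s s' (u : 'rV[R]_N),
     f i (u 0 i - s) != 0 -> f j (u 0 j - s') != 0 ->
     zakharov_at (dressing_tilde r F) i j s s' u) :
  let beta := rotation K in
  forall (i j : 'I_N) (s : R) (u : 'rV[R]_N), i != j ->
    pderive i (beta i j s) u + pderive j (beta j i s) u
      + \sum_(p < N | (p != i) && (p != j)) beta p i s u * beta p j s u = 0
    /\
    (cderivable (r i) (u 0 i - s) 1 -> cderivable (r j) (u 0 j - s) 1 ->
     r i (u 0 i - s)
       * pderive i (fun v => r i (v 0 i - s) * beta i j s v) u
     + r j (u 0 j - s)
       * pderive j (fun v => r j (v 0 j - s) * beta j i s v) u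
     + \sum_(p < N | (p != i) && (p != j))
         f p (u 0 p - s) * beta p i s u * beta p j s u = 0).
Proof.
move=> beta i j s u ij; have ji : j != i by rewrite eq_sym.
split.
(* For the constant weight, compatibility is the integrability of the rows of [K], and the condition
   on the derivative concerns the zero function. *)
- have K_one : weight_compatible (fun _ _ => 1) K.
    move=> k l t v; have iK := K_integrable K_sol k l t v.
    have mD : measurable ((`[t, +oo[%classic : set R) : set (measurableTypeR R)).
      exact: measurable_itv.
    split; first by apply: (eq_cintegrable mD _ iK) => q _; rewrite mul1r.
    apply: (eq_cintegrable mD _ (cintegrableZl mD 0 iK)) => q _.
    by rewrite (is_cderiveE (is_cderive_cst _ _)).
  have := weighted_identity F_reg K_sol K_reg (fun=> C1_cst _ 1) K_one i j s
    (zakharov_antisymmetric F_reg (fun l m x y => F_zakharov l m x y u)).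
  rewrite (sum_pair_rest _ ij) /weighted_row !(is_cderiveE (is_cderive_cst _ _)).
  rewrite /beta !(pderive_rotation F_reg K_sol K_reg)//.
  rewrite /rotation => /eqP; rewrite -subr_eq0 => /eqP E.
  (* The left side of the goal is minus the defect [E] of the weighted identity, so after this
     substitution only algebra remains. *)
  rewrite -[RHS]oppr0 -[X in _ = - X]E.
  under [X in _ = - (_ - (_ + X))]eq_bigr do rewrite /= mul1r.
  ring.
move=> dri drj.
have := weighted_identity F_reg K_sol K_reg f_C1 K_weight i j s
  (zakharov_tilde_antisymmetric F_reg f_C1 r_sqrt f_neq0 (fun l m x y =>
    Ft_zakharov l m x y u)).
rewrite (sum_pair_rest _ ij) /weighted_row.
rewrite -(sqrt_branch_derive r_sqrt dri) -(sqrt_branch_derive r_sqrt drj).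
rewrite /beta !(pderive_sqrt_rotation K_reg)// !(pderive_rotation F_reg K_sol K_reg)//.
rewrite -(r_sqrt i (u 0 i - s)).1 -(r_sqrt j (u 0 j - s)).1.
rewrite /rotation => /eqP; rewrite -subr_eq0 => /eqP E.
rewrite -[RHS]oppr0 -[X in _ = - X]E; ring.
Qed.
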